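(* Assume that $\eta=\xi$ a.s., that the distribution of $\xi$ is nonlattice and $s^2:=\mathrm{Var}\,\xi\in(0,\infty)$. Then, for any $j\in\mathbb{N}$, $$\lim_{t\to\infty}\frac{\mathrm{Var}\,N_j(t)}{t^{2j-1}}=\frac{s^2}{(2j-1)\,((j-1)!)^2\,m^{2j+1}},$$ where $m=\mathbb{E}\xi<\infty$.
   Context: Let $(\xi_i,\eta_i)_{i\in\mathbb{N}}$ be independent copies of a random vector $(\xi,\eta)$ whose components are a.s. positive and arbitrarily dependent. Put $S_0:=0$, $S_i:=\xi_1+\cdots+\xi_i$ and $T_i:=S_{i-1}+\eta_i$ for $i\in\mathbb{N}$; the sequence $T:=(T_i)_{i\in\mathbb{N}}$ is called a perturbed random walk (when $\eta=\xi$ a.s., $T_i=S_i$). General branching process generated by $T$: at time $0$ there is one individual, the ancestor, whose children (the first generation) have birth times given by the points of $T$. The individuals of the $(j-1)$th generation produce the $j$th generation: the shifts of the birth times of the children of an individual with respect to that individual's birth time are distributed as a copy of $T$, the copies for different mothers being independent of each other and of the past. Formally, let $T^{(u)}=(T^{(u)}_i)_{i\in\mathbb{N}}$, $u\in\bigcup_{n\ge 0}\mathbb{N}^n$, be independent copies of $T$; the $j$th generation individual $u=(u_1,\ldots,u_j)\in\mathbb{N}^j$ has birth time $\sum_{i=1}^j T^{((u_1,\ldots,u_{i-1}))}_{u_i}$. For $j\in\mathbb{N}$ and $t\ge 0$, $N_j(t)$ denotes the number of $j$th generation individuals with birth times $\le t$. The distribution of a positive random variable is called nonlattice if it is not concentrated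 on any lattice $(nd)_{n\in\mathbb{N}_0}$, $d>0$, where $\mathbb{N}_0=\mathbb{N}\cup\{0\}$. *)

(* Defs.v *)
From HB Require Import structures.
From mathcomp Require Import all_boot all_order all_algebra.
From mathcomp Require Import all_classical all_reals all_analysis.

Set Implicit Arguments.
Unset Strict Implicit.
Unset Printing Implicit Defensive.

Import Order.TTheory GRing.Theory Num.Theory.
Import numFieldNormedType.Exports.

Local Open Scope classical_set_scope.
Local Open Scope ring_scope.

Section independence.
Context {d d' : measure_display} {Omega : measurableType d}
  {E : measurableType d'} {R : realType} (P : probability Omega R).

Definition mutually_independent {I : choiceType} (Z : I -> Omega -> E) : Prop :=
  forall (s : seq I) (B : I -> set E), uniq s ->
    (forall i, measurable (B i)) ->
    P (\bigcap_(i in [set` s]) (Z i @^-1` B i)) =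
    (\prod_(i <- s) P (Z i @^-1` B i))%E.

Definition identically_distributed (X Y : Omega -> E) : Prop :=
  forall B : set E, measurable B -> P (X @^-1` B) = P (Y @^-1` B).

Definition independent_copies {I : choiceType} (X : Omega -> E)
    (Z : I -> Omega -> E) : Prop :=
  [/\ forall i, measurable_fun [set: Omega] (Z i),
      forall i, identically_distributed (Z i) X &
      mutually_independent Z].

End independence.

(* Cylinder sets with a one-dimensional base: they generate the product
   sigma-algebra on the space of real sequences. *)
Definition coordinate_cylinders (R : realType) : set (set (nat -> R)) :=
  [set A | exists (i : nat) (B : set R),
    measurable B /\ A = [set x | B (x i)]].

Notation real_sequences R := (g_sigma_algebraType (@coordinate_cylinders R)).

(* Sequences are indexed from 0: index i stands for i + 1 in the usual
   notation, so this is T_{i+1} = (xi_1 + ... + xi_i) + eta_{i+1}. *)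
Definition perturbed_walk {Omega : Type} {R : realType}
    (xi eta : nat -> Omega -> R) (w : Omega) : real_sequences R :=
  fun i : nat => \sum_(k < i) xi k w + eta i w.

Section branching.
Context {Omega : Type} {R : realType}.
Context (T : seq nat -> Omega -> real_sequences R).

(* The i-th step of the line of descent leading to u is made by the mother
   (u_1, ..., u_{i-1}), whose child number u_i is the next ancestor of u. *)
Definition birth_time (u : seq nat) (w : Omega) : R :=
  \sum_(i < size u) T (take i u) w (nth 0%N u i).

(* The number is a.s. finite under the assumptions in which it is used; [fine]
   sends the value +oo to 0. *)
Definition generation_count (j : nat) (t : R) (w : Omega) : R :=
  fine (counting [set u : seq nat | size u = j /\ birth_time u w <= t]).

End branching.

Definition nonlattice {d : measure_display} {Omega : measurableType d}
    {R : realType} (P : probability Omega R) (X : Omega -> R) : Prop :=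
  forall h : R, 0 < h ->
    P (X @^-1` [set x | exists n : nat, x = n%:R * h]) != 1%E.

(* Main.v *)
Require Import Defs.
From HB Require Import structures.
From mathcomp Require Import finmap.
From mathcomp Require Import all_boot all_order all_algebra.
From mathcomp Require Import all_classical all_reals all_analysis.
From mathcomp Require Import measurable_realfun ring lra.

(** For a nondecreasing function [f] vanishing on the negative half-line let
    [V f t] be the expectation of the sum of [f (t - S_k)] over [k >= 1], let
    [q f t] be the variance of that sum, and let [f_i] be the [i]-th iterate of
    [V] on the indicator of the nonnegative half-line, so that [f_j t] is the
    expected size of the [j]-th generation at time [t].

    Branching.  The last generation is unfolded.  Given the first [l]
    generations, the individuals of generation [l] have independent litters, so
    passing from generation [l.+1] to generation [l] replaces [f] by [V f] in the
    second moment of the sum of [f (t - birth time)] and leaves behind the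
    expected sum of [q f (t - birth time)] over generation [l]
    ([integral_generation_sqr_succ]).  After all steps the variance of the [j]-th
    generation is [q f_(j-1)] plus the terms [V^l (q f_(j-1-l))], [0 < l < j].
    Since [f_i] is of order [t^i] and [q f_i] of order [t^(2i+1)], the [l]-th
    term is of order [t^(2j-1-l)], and only [q f_(j-1)] matters.

    One walk.  With [m] and [s2] the mean and the variance of the steps [xi_k],
    [m * sum_k f (t - S_k)] is the sum of [Y = sum_k (m - xi_k) f (t - S_k)] and
    of [A = sum_k xi_k f (t - S_k)], where now [k >= 0] and [xi_k] is the step
    that leads from [S_k] to the next position.  The summands of [Y] are
    martingale differences, so [Y] is centered with second moment
    [s2 * E sum_k f (t - S_k)^2] ([Ex_centered_sum_sqr]).  On the other hand [A]
    is an upper Riemann sum for the integral of [f] over [[0, t]], along the mesh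
    formed by the walk: as [f] is monotone it exceeds the integral by at most
    [f t] times the largest step begun before [t]
    ([riemann_error_bounds]), whose second moment is [o(t)] because the steps are
    square integrable ([Ex_riemann_error_small]).  Hence [A] is deterministic up
    to an error that is negligible in the mean and in the variance.  Taking
    expectations gives the growth of [V f] from that of the integral of [f]
    ([asym_renewal]), and taking variances gives
    [m^2 * q f ~ s2 * E sum_k f (t - S_k)^2] ([asym_renewal_var]); with
    [f_i ~ t^i / (i! m^i)] this is the stated limit. *)

Set Implicit Arguments.
Unset Strict Implicit.
Unset Printing Implicit Defensive.

Import Order.TTheory GRing.Theory Num.Theory.
Import numFieldNormedType.Exports.

Local Open Scope classical_set_scope.
Local Open Scope ring_scope.

(** * Independence of one member of a family from all the others *)

Section mixing.
Context {d d' : measure_display} {Omega : measurableType d}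
  {E : measurableType d'} {R : realType} (P : probability Omega R).
Context {I : choiceType} (Z : I -> Omega -> E) (i0 : I).

(** The finite intersections of events of the members with index different from
    [i0] form a pi-system; [g_sigma_algebraType] turns it into a second measurable
    structure on the same sample space, for which a measurable map is one that
    does not look at the member [i0]. *)
Definition other_cylinders : set (set Omega) :=
  [set A | exists (s : seq I) (B : I -> set E),
     [/\ uniq s, i0 \notin s, forall i, measurable (B i) &
         A = \bigcap_(i in [set` s]) (Z i @^-1` B i)]].

Local Notation others := (g_sigma_algebraType other_cylinders).

Hypothesis mZ : forall i, measurable_fun [set: Omega] (Z i).
Hypothesis indZ : mutually_independent P Z.

Lemma measurable_other_cylinders :
  other_cylinders `<=` (measurable : set (set Omega)).
Proof.
move=> _ [s [B [_ _ mB ->]]].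
by apply: fin_bigcap_measurable => // i _; rewrite -[_ @^-1` _]setTI; exact: mZ.
Qed.

Lemma setI_closed_other_cylinders : setI_closed other_cylinders.
Proof.
move=> _ _ [s [B [us s0 mB ->]]] [s' [B' [us' s0' mB' ->]]].
exists (undup (s ++ s')), (fun i => (if i \in s then B i else setT) `&`
  (if i \in s' then B' i else setT)); split.
- exact: undup_uniq.
- by rewrite mem_undup mem_cat negb_or s0.
- by move=> i; apply: measurableI; case: ifP.
- apply/seteqP; split => [w [/= h h'] i /=|w /= h].
    rewrite mem_undup mem_cat => _; split; case: ifPn => // ?; [exact: h|exact: h'].
  split=> i /= iS.
    have /= := h i; rewrite mem_undup mem_cat iS /= => /(_ isT) [].
    by [].
  by have /= := h i; rewrite mem_undup mem_cat iS orbT /= => /(_ isT) [].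
Qed.

Lemma measurable_to_others : measurable_fun [set: Omega] (idfun : Omega -> others).
Proof.
apply: measurability => //= _ [A HA <-].
by rewrite setTI; exact: measurable_other_cylinders.
Qed.

Lemma measurable_others (i : I) :
  i != i0 -> measurable_fun [set: others] (Z i : others -> E).
Proof.
move=> ii0 _ B mB; rewrite setTI; apply: sub_sigma_algebra.
exists [:: i], (fun=> B); split => //; first by rewrite inE eq_sym.
by rewrite set_cons1 bigcap_set1.
Qed.

(** For fixed [A] both sides are finite measures of [B], and they agree on the
    pi-system by independence. *)
Lemma independent_others (A : set E) (B : set others) :
  measurable A -> measurable B ->
  P (Z i0 @^-1` A `&` B) = (P (Z i0 @^-1` A) * P B)%E.
Proof.
move=> mA mB.
have mZA : measurable (Z i0 @^-1` A) by rewrite -[_ @^-1` _]setTI; exact: mZ.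
pose m1 : {measure set Omega -> \bar R} := mrestr P mZA.
have nn : 0 <= fine (P (Z i0 @^-1` A)) by exact: fine_ge0.
pose m2 : {measure set Omega -> \bar R} := mscale (NngNum nn) P.
have : m1 B = m2 B.
  apply: (@g_sigma_algebra_measure_unique _ R Omega other_cylinders
    measurable_other_cylinders (fun=> setT)) => //.
  - by move=> _; exists [::], (fun=> setT); split => //; rewrite set_nil bigcap_set0.
  - by rewrite bigcup_const //; exists 0%N.
  - exact: setI_closed_other_cylinders.
  - move=> _ [s [C [us s0 mC ->]]].
    rewrite /m1 /m2 /= /mrestr /mscale /=.
    rewrite fineK ?fin_num_measure //.
    have := indZ (s := i0 :: s) (B := fun i => if i == i0 then A else C i).
    rewrite /= s0 us => /(_ isT).
    have mAC : forall i, measurable (if i == i0 then A else C i).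
      by move=> i; case: ifP.
    move=> /(_ mAC); rewrite big_cons eqxx.
    have iCE : forall i, i \in s -> (if i == i0 then A else C i) = C i.
      by move=> i; case: eqP => // ->; rewrite (negbTE s0).
    have -> : \bigcap_(i in [set` i0 :: s]) (Z i @^-1` (if i == i0 then A else C i)) =
              \bigcap_(i in [set` s]) (Z i @^-1` C i) `&` Z i0 @^-1` A.
      apply/seteqP; split => [w h|w [h1 h2] i /=].
        split => [i /= iS|]; last by have := h i0; rewrite /= eqxx mem_head; apply.
        by have := h i; rewrite /= iCE // inE iS orbT; exact.
      by rewrite inE; case: eqP => [-> _ //|_ /= iS]; exact: h1.
    rewrite indZ // => ->; congr (_ * _)%E.
    by rewrite !big_seq; apply: eq_bigr => i iS; rewrite iCE.
  - by move=> _; rewrite (le_lt_trans (probability_le1 _ _)) ?ltry // setTI.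
rewrite /m1 /m2 /= /mrestr /mscale /= fineK ?fin_num_measure // setIC.
by [].
Qed.

(** The pair formed by [Z i0] and by the identity, seen with values in the sample
    space that ignores [i0], has a product law; the formula is then Tonelli's
    theorem. It allows to integrate [Z i0] out while everything else is kept. *)
Lemma integral_independent (h : E * others -> \bar R) :
  measurable_fun setT h -> (forall x, 0 <= h x)%E ->
  (\int[P]_w h (Z i0 w, w) = \int[P]_w \int[P]_v h (Z i0 v, w))%E.
Proof.
move=> mh h0.
have mid : measurable_fun [set: Omega] (idfun : Omega -> others).
  exact: measurable_to_others.
pose pZ : {mfun Omega >-> E} := HB.pack (Z i0) (isMeasurableFun.Build _ _ _ _ _ (mZ i0)).
pose pid : {mfun Omega >-> others} := HB.pack (idfun : Omega -> others)
  (isMeasurableFun.Build _ _ _ _ _ mid).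
have mp : measurable_fun [set: Omega] (fun w : Omega => (Z i0 w, w : others)).
  exact: measurable_fun_pair.
pose pp : {mfun Omega >-> (E * others)%type} := HB.pack (fun w : Omega => (Z i0 w, w : others))
  (isMeasurableFun.Build _ _ _ _ _ mp).
transitivity (\int[distribution P pp]_x h x)%E.
  by rewrite ge0_integral_distribution.
transitivity (\int[distribution P pZ \x distribution P pid]_x h x)%E.
  apply: eq_measure_integral => A mA _; apply/esym; apply: product_measure_unique => //.
  by move=> B C mB mC; exact: independent_others.
rewrite fubini_tonelli2 // ge0_integral_distribution //=; last 2 first.
- exact: measurable_fun_fubini_tonelli_G.
- by move=> y; exact: integral_ge0.
apply: eq_integral => w _ /=; rewrite /fubini_G ge0_integral_distribution //.
exact: measurableT_comp mh (measurable_pair2 _).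
Qed.

End mixing.

(** * Integrable and square integrable random variables *)

Section expectation_calculus.
Context {d : measure_display} {Omega : measurableType d} {R : realType}
  (P : probability Omega R).
Implicit Types (X Y : Omega -> R).

Definition int1 X := P.-integrable setT (EFin \o X).
Definition int2 X := measurable_fun [set: Omega] X /\ int1 (fun w => X w ^+ 2).
Local Notation Ex X := (Rintegral P setT X).

Lemma int1_measurable X : int1 X -> measurable_fun [set: Omega] X.
Proof. by move=> /measurable_int /measurable_EFinP. Qed.

Lemma int1_le X Y : measurable_fun [set: Omega] X ->
  (forall w, `|X w| <= Y w) -> int1 Y -> int1 X.
Proof.
move=> mX XY; apply: le_integrable => //; first exact/measurable_EFinP.
by move=> w _ /=; rewrite lee_fin (le_trans (XY w)) // ler_norm.
Qed.

Lemma int1_cst c : int1 (fun=> c).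
Proof. exact: finite_measure_integrable_cst. Qed.

Lemma int1D X Y : int1 X -> int1 Y -> int1 (fun w => X w + Y w).
Proof. by move=> iX iY; apply: eq_integrable (integrableD _ iX iY). Qed.

Lemma int1Z c X : int1 X -> int1 (fun w => c * X w).
Proof. by move=> iX; apply: eq_integrable (integrableZl _ c iX). Qed.

Lemma int1B X Y : int1 X -> int1 Y -> int1 (fun w => X w - Y w).
Proof. by move=> iX iY; apply: eq_integrable (integrableB _ iX iY). Qed.

Lemma int1_sum n (X : nat -> Omega -> R) : (forall k, int1 (X k)) ->
  int1 (fun w => \sum_(k < n) X k w).
Proof.
move=> iX; elim: n => [|n IH].
  by apply: eq_integrable (int1_cst 0) => // w _; rewrite /= big_ord0.
apply: eq_integrable (int1D IH (iX n)) => // w _.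
by rewrite /= big_ord_recr.
Qed.

Lemma ExD X Y : int1 X -> int1 Y ->
  Ex (fun w => X w + Y w) = Ex X + Ex Y.
Proof. by move=> iX iY; rewrite RintegralD. Qed.

Lemma ExB X Y : int1 X -> int1 Y ->
  Ex (fun w => X w - Y w) = Ex X - Ex Y.
Proof. by move=> iX iY; rewrite RintegralB. Qed.

Lemma ExZ c X : int1 X -> Ex (fun w => c * X w) = c * Ex X.
Proof. by move=> iX; rewrite RintegralZl. Qed.

Lemma Ex_cst c : Ex (fun=> c) = c.
Proof. by rewrite Rintegral_cst // [X in fine X]probability_setT mulr1. Qed.

Lemma Ex_sum n (X : nat -> Omega -> R) : (forall k, int1 (X k)) ->
  Ex (fun w => \sum_(k < n) X k w) = \sum_(k < n) Ex (X k).
Proof.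
move=> iX; elim: n => [|n IH].
  rewrite big_ord0 -[RHS](Ex_cst 0); apply: eq_Rintegral => w _.
  by rewrite big_ord0.
rewrite big_ord_recr /= -IH -ExD //; last exact: int1_sum.
by apply: eq_Rintegral => w _; rewrite big_ord_recr.
Qed.

Lemma Ex_le X Y : int1 X -> int1 Y -> (forall w, X w <= Y w) -> Ex X <= Ex Y.
Proof. by move=> iX iY XY; apply: le_Rintegral. Qed.

Lemma Ex_ge0 X : (forall w, 0 <= X w) -> 0 <= Ex X.
Proof. by move=> X0; apply: Rintegral_ge0. Qed.

Lemma EFin_Ex X : int1 X -> (Ex X)%:E = (\int[P]_w (X w)%:E)%E.
Proof. by move=> iX; rewrite /Rintegral fineK //; exact: integrable_fin_num. Qed.

Lemma int2_int1 X : int2 X -> int1 X.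
Proof.
move=> [mX iX]; apply: int1_le (int1D (int1_cst 1) iX) => // w.
by rewrite -real_normK ?num_real //; nra.
Qed.

Lemma int2_le X Y : measurable_fun [set: Omega] X ->
  (forall w, `|X w| <= `|Y w|) -> int2 Y -> int2 X.
Proof.
move=> mX XY [mY iY]; split => //; apply: int1_le iY.
  exact: measurable_funX.
move=> w; rewrite normrX -[leRHS]real_normK ?num_real //.
by rewrite ler_pXn2r ?nnegrE.
Qed.

Lemma int1M X Y : int2 X -> int2 Y -> int1 (fun w => X w * Y w).
Proof.
move=> [mX iX] [mY iY]; apply: int1_le (int1D iX iY).
  exact: measurable_funM.
move=> w; rewrite normrM -(real_normK (num_real (X w))) -(real_normK (num_real (Y w))).
by have := sqr_ge0 (`|X w| - `|Y w|); have := normr_ge0 (X w); have := normr_ge0 (Y w); nra.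
Qed.

Lemma int2D X Y : int2 X -> int2 Y -> int2 (fun w => X w + Y w).
Proof.
move=> iX iY; have iXY := int1M iX iY; case: iX iY => mX iX [mY iY].
split; first exact: measurable_funD.
apply: eq_integrable (int1D (int1D iX iY) (int1Z 2 iXY)) => // w _ /=.
by congr (_%:E); ring.
Qed.

Lemma int2Z c X : int2 X -> int2 (fun w => c * X w).
Proof.
move=> [mX iX]; split; first exact: measurable_funM.
by apply: eq_integrable (int1Z (c ^+ 2) iX) => // w _ /=; rewrite exprMn.
Qed.

Lemma int2B X Y : int2 X -> int2 Y -> int2 (fun w => X w - Y w).
Proof.
move=> iX iY; have := int2D iX (int2Z (-1) iY).
by congr int2; apply/funext => w; rewrite mulN1r.
Qed.

Lemma int2_bounded X c : measurable_fun [set: Omega] X ->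
  (forall w, `|X w| <= c) -> int2 X.
Proof.
move=> mX Xc; apply: (@int2_le X (fun=> c)) => //.
  by move=> w; rewrite (le_trans (Xc w)) // ler_norm.
by split => //; exact: int1_cst.
Qed.

Lemma int2_cst c : int2 (fun=> c).
Proof. by apply: (@int2_bounded _ `|c|). Qed.

Lemma int2_sum n (X : nat -> Omega -> R) : (forall k, int2 (X k)) ->
  int2 (fun w => \sum_(k < n) X k w).
Proof.
move=> iX; elim: n => [|n IH].
  have := int2_cst 0.
  by congr int2; apply/funext => w; rewrite big_ord0.
have := int2D IH (iX n).
by congr int2; apply/funext => w; rewrite big_ord_recr.
Qed.

(** The weighted form of the triangle inequality in [L^2]: letting [eta] tend to
    [0] shows that a perturbation small in [L^2] does not change second moments to
    first order. *)
Lemma Ex_sqrD_le X Y eta : 0 < eta -> int2 X -> int2 Y ->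
  Ex (fun w => (X w + Y w) ^+ 2) <=
  (1 + eta) * Ex (fun w => X w ^+ 2) + (1 + eta^-1) * Ex (fun w => Y w ^+ 2).
Proof.
move=> eta0 iX iY; have [_ iD] := int2D iX iY.
case: iX iY => mX iX [mY iY].
rewrite -!ExZ // -ExD; [|exact: int1Z|exact: int1Z].
apply: Ex_le => //; first by apply: int1D; exact: int1Z.
move=> w; rewrite -subr_ge0.
have -> : (1 + eta) * X w ^+ 2 + (1 + eta^-1) * Y w ^+ 2 - (X w + Y w) ^+ 2 =
   eta^-1 * (eta * X w - Y w) ^+ 2 by field; rewrite gt_eqF.
by rewrite mulr_ge0 ?sqr_ge0 // invr_ge0 ltW.
Qed.

Lemma Ex_sqr_centered X : int2 X ->
  Ex (fun w => (X w - Ex X) ^+ 2) = Ex (fun w => X w ^+ 2) - (Ex X) ^+ 2.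
Proof.
move=> iX; have i1 := int2_int1 iX; case: iX => mX iX.
transitivity (Ex (fun w => (X w ^+ 2 - 2 * Ex X * X w) + (Ex X) ^+ 2)).
  by apply: eq_Rintegral => w _; ring.
rewrite ExD; [|by apply: int1B => //; exact: int1Z|exact: int1_cst].
by rewrite ExB //; [rewrite ExZ // Ex_cst; ring|exact: int1Z].
Qed.

Lemma Ex_sqr_ge X : int2 X -> (Ex X) ^+ 2 <= Ex (fun w => X w ^+ 2).
Proof.
move=> iX; rewrite -subr_ge0 -Ex_sqr_centered //.
by apply: Ex_ge0 => w; exact: sqr_ge0.
Qed.

Lemma variance_int2 (X : Omega -> R) : int2 X ->
  'V_P[X]%E = (Ex (fun w => X w ^+ 2) - (Ex X) ^+ 2)%:E.
Proof.
move=> iX; rewrite -Ex_sqr_centered // EFin_Ex; last first.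
  by case: (int2B iX (int2_cst (Ex X))).
rewrite /variance unlock [in LHS]unlock; apply: eq_integral => w _.
by rewrite expr2.
Qed.

Lemma int2_variance (X : Omega -> R) : measurable_fun [set: Omega] X ->
  ('V_P[X] < +oo)%E -> int2 X.
Proof.
move=> mX; set c := fine 'E_P[X]%E.
have -> : 'V_P[X]%E = (\int[P]_w ((X w - c) ^+ 2)%:E)%E.
  rewrite /variance unlock [in LHS]unlock; apply: eq_integral => w _.
  by rewrite expr2 /c unlock.
move=> V; suff ic : int2 (fun w => X w - c).
  by have := int2D ic (int2_cst c); congr int2; apply/funext => w; rewrite subrK.
have mc : measurable_fun [set: Omega] (fun w => X w - c) by exact: measurable_funB.
split => //; apply/integrableP; split.
  by apply/measurable_EFinP; exact: measurable_funX.
under eq_integral do rewrite /= ger0_norm ?sqr_ge0 //.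
exact: V.
Qed.

End expectation_calculus.

(** * Equality in law and products of independent factors *)

Section transfer.
Context {d d' : measure_display} {Omega : measurableType d}
  {E : measurableType d'} {R : realType} (P : probability Omega R).

Lemma integral_identically_distributed (X Y : Omega -> E) (h : E -> \bar R) :
  measurable_fun [set: Omega] X -> measurable_fun [set: Omega] Y ->
  identically_distributed P X Y ->
  measurable_fun [set: E] h -> (forall x, 0 <= h x)%E ->
  (\int[P]_w h (X w) = \int[P]_w h (Y w))%E.
Proof.
move=> mX mY XY mh h0.
pose pX : {mfun Omega >-> E} := HB.pack X (isMeasurableFun.Build _ _ _ _ _ mX).
pose pY : {mfun Omega >-> E} := HB.pack Y (isMeasurableFun.Build _ _ _ _ _ mY).
have <- := @ge0_integral_distribution _ _ _ _ _ P pX h mh h0.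
have <- := @ge0_integral_distribution _ _ _ _ _ P pY h mh h0.
by apply: eq_measure_integral => A mA _; exact: XY.
Qed.

End transfer.

Section independent_product.
Context {d d' : measure_display} {Omega : measurableType d}
  {E : measurableType d'} {R : realType} (P : probability Omega R).
Context {I : choiceType} (Z : I -> Omega -> E) (i0 : I).
Local Notation others := (g_sigma_algebraType (other_cylinders Z i0)).
Local Notation Ex X := (Rintegral P setT X).
Hypothesis mZ : forall i, measurable_fun [set: Omega] (Z i).
Hypothesis indZ : mutually_independent P Z.

Lemma measurable_from_others {d2} {E2 : measurableType d2} (W : others -> E2) :
  measurable_fun [set: others] W -> measurable_fun [set: Omega] (W : Omega -> E2).
Proof.
by move=> mW; apply: (measurableT_comp mW); exact: measurable_to_others.
Qed.

Lemma ge0_independent_product (phi : E -> R) (W : others -> R) :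
  measurable_fun [set: E] phi -> (forall x, 0 <= phi x) ->
  int1 P (fun w => phi (Z i0 w)) ->
  measurable_fun [set: others] W -> (forall w, 0 <= W w) -> int1 P W ->
  int1 P (fun w => phi (Z i0 w) * W w) /\
  Ex (fun w => phi (Z i0 w) * W w) = Ex (fun w => phi (Z i0 w)) * Ex W.
Proof.
move=> mphi phi0 iphi mW W0 iW.
have mWO := measurable_from_others mW.
have mphiZ : measurable_fun [set: Omega] (fun w => phi (Z i0 w)).
  exact: measurableT_comp.
suff H : (\int[P]_w (phi (Z i0 w) * W w)%:E =
    (Ex (fun w => phi (Z i0 w)) * Ex W)%:E)%E.
  split; last by rewrite /Rintegral H.
  apply/integrableP; split.
    by apply/measurable_EFinP; exact: measurable_funM.
  under eq_integral => w _ do rewrite /= ger0_norm ?mulr_ge0 //.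
  by rewrite H ltry.
have := integral_independent (h := fun x : E * others => (phi x.1 * W x.2)%:E) mZ indZ.
move=> ->.
- transitivity (\int[P]_w ((Ex (fun w => phi (Z i0 w)))%:E * (W w)%:E))%E.
    apply: eq_integral => w _ /=; rewrite EFin_Ex // -ge0_integralZr ?lee_fin //=.
    + exact/measurable_EFinP.
    + by move=> v _; rewrite lee_fin.
  rewrite ge0_integralZl ?lee_fin //; first by rewrite -EFin_Ex.
  + exact/measurable_EFinP.
  + by move=> w _; rewrite lee_fin.
  + exact: Ex_ge0.
- apply/measurable_EFinP; apply: measurable_funM.
    exact: measurableT_comp mphi measurable_fst.
  exact: measurableT_comp mW measurable_snd.
- by move=> x; rewrite lee_fin mulr_ge0.
Qed.

(** Reduces to the nonnegative case by splitting [W] into positive and negative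
    parts. *)
Lemma independent_product (phi : E -> R) (W : others -> R) :
  measurable_fun [set: E] phi -> (forall x, 0 <= phi x) ->
  int1 P (fun w => phi (Z i0 w)) ->
  measurable_fun [set: others] W -> int1 P W ->
  int1 P (fun w => phi (Z i0 w) * W w) /\
  Ex (fun w => phi (Z i0 w) * W w) = Ex (fun w => phi (Z i0 w)) * Ex W.
Proof.
move=> mphi phi0 iphi mW iW.
have mWO := measurable_from_others mW.
pose Wp : others -> R := fun w => Num.max (W w) 0.
pose Wn : others -> R := fun w => Num.max (- W w) 0.
have mWp : measurable_fun [set: others] Wp.
  exact: (measurable_maxr mW (measurable_cst _)).
have mWn : measurable_fun [set: others] Wn.
  by apply: measurable_maxr => //; exact: measurableT_comp.
have iWp : int1 P Wp.
  apply: int1_le (integrable_norm iW); first exact: measurable_from_others.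
  by move=> w; rewrite /Wp /=; case: (leP (W w) 0) => ?; rewrite ?normr0.
have iWn : int1 P Wn.
  apply: int1_le (integrable_norm iW); first exact: measurable_from_others.
  by move=> w; rewrite /Wn /=; case: (leP (- W w) 0) => ?; rewrite ?normr0 ?normrN.
have WE : W = (fun w => Wp w - Wn w).
  apply/funext => w; rewrite /Wp /Wn; by case: (leP (W w) 0) => ?; case: (leP (- W w) 0) => ?; lra.
have [ip Ep] := ge0_independent_product mphi phi0 iphi mWp
  (fun w => ltac:(by rewrite le_max lexx orbT)) iWp.
have [ineg En] := ge0_independent_product mphi phi0 iphi mWn
  (fun w => ltac:(by rewrite le_max lexx orbT)) iWn.
have -> : (fun w => phi (Z i0 w) * W w) =
   (fun w => phi (Z i0 w) * Wp w - phi (Z i0 w) * Wn w).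
  by apply/funext => w; rewrite WE mulrBr.
split; first exact: int1B.
by rewrite ExB // Ep En -mulrBr -ExB // -WE.
Qed.

End independent_product.

(** * Nondecreasing functions on the half-line and their primitives *)

Section growth.
Context {R : realType}.
Implicit Types (f g F G : R -> R).

(** Every function that is summed along the walk has this shape: a sum of
    [f (t - S_k)] then only sees the visits before [t]. *)
Definition growth f := {homo f : x y / x <= y} /\ forall x, x < 0 -> f x = 0.

Lemma growth_ge0 f x : growth f -> 0 <= f x.
Proof.
move=> [mf f0]; have [x0|x0] := ltP x 0; first by rewrite f0.
by rewrite -(f0 (-1)) ?ltrN10 // mf // (le_trans _ x0) // lerN10.
Qed.

Lemma growth_measurable f : growth f -> measurable_fun [set: R] f.
Proof.
by move=> [mf _]; apply: nondecreasing_measurable => // x y xy; exact: mf.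
Qed.

Lemma growthM f g : growth f -> growth g -> growth (fun x => f x * g x).
Proof.
move=> gf gg; split=> [x y xy|x x0]; last by case: gf => _ ->; rewrite ?mul0r.
by rewrite ler_pM ?(growth_ge0 _ gf) ?(growth_ge0 _ gg) //; [case: gf => ->|case: gg => ->].
Qed.

Lemma growthD f g : growth f -> growth g -> growth (fun x => f x + g x).
Proof.
move=> [f1 f2] [g1 g2]; split=> [x y xy|x x0]; first by rewrite lerD ?f1 ?g1.
by rewrite f2 // g2 // addr0.
Qed.

Lemma growthZ (c : R) f : 0 <= c -> growth f -> growth (fun x => c * f x).
Proof.
move=> c0 [f1 f2]; split=> [x y xy|x x0]; first by rewrite ler_wpM2l ?f1.
by rewrite f2 // mulr0.
Qed.

(** The division by the factorial makes [ppow p.+1] the primitive of [ppow p], and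
    [ppow 0] is the indicator of the nonnegative half-line. *)
Definition ppow (p : nat) (x : R) : R := if 0 <= x then x ^+ p / p`!%:R else 0.

Lemma growth_ppow p : growth (ppow p).
Proof.
split=> [x y xy|x x0]; last by rewrite /ppow leNgt x0.
rewrite /ppow; case: (leP 0 x) => x0; last by case: ifP => // y0; rewrite divr_ge0 ?exprn_ge0.
have y0 := le_trans x0 xy.
by rewrite y0 ler_wpM2r ?invr_ge0 // lerXn2r ?nnegrE.
Qed.

Lemma ppow0 (x : R) : 0 <= x -> ppow 0 x = 1.
Proof. by move=> x0; rewrite /ppow x0 expr0 fact0 divr1. Qed.

Lemma ppow1 (x : R) : 0 <= x -> ppow 1 x = x.
Proof. by move=> x0; rewrite /ppow x0 expr1 factS fact0 divr1. Qed.

(** [G] is the integral of [f] from [0]. The increments of [G] are compared with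
    rectangles because this relation is preserved by averaging over
    translations. *)
Definition primitive f G := [/\ growth f, growth G &
  forall x h, 0 <= h -> h * f (x - h) <= G x - G (x - h) <= h * f x].

(** The mean value inequality for a power, read off the factorization of
    [x ^+ p.+1 - y ^+ p.+1]. *)
Lemma subrXX_bounds p (x y : R) : 0 <= y -> y <= x ->
  p.+1%:R * y ^+ p * (x - y) <= x ^+ p.+1 - y ^+ p.+1 <= p.+1%:R * x ^+ p * (x - y).
Proof.
move=> y0 yx; have x0 := le_trans y0 yx.
rewrite subrXX [(x - y) * _]mulrC.
have sumc (z : R) : p.+1%:R * z ^+ p = \sum_(i < p.+1) z ^+ p.
  by rewrite sumr_const card_ord mulr_natl.
apply/andP; split; apply: ler_wpM2r; rewrite ?subr_ge0 // sumc; apply: ler_sum => i _ /=.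
  rewrite -[in leLHS](subnK (leq_ord i)) exprD ler_wpM2r ?exprn_ge0 //.
  by rewrite lerXn2r ?nnegrE.
rewrite -[in leRHS](subnK (leq_ord i)) exprD ler_wpM2l ?exprn_ge0 //.
by rewrite lerXn2r ?nnegrE.
Qed.

Lemma primitive_ppow p : primitive (ppow p) (ppow p.+1).
Proof.
split=> [||x h h0]; [exact: growth_ppow|exact: growth_ppow|].
have e0 : 0 <= (p.+1`!%:R)^-1 :> R by rewrite invr_ge0.
have eE : (p`!%:R)^-1 = p.+1%:R * (p.+1`!%:R)^-1 :> R.
  by rewrite factS natrM invfM mulrA divff ?mul1r ?pnatr_eq0.
have [x0|x0] := ltP x 0.
  have xh0 : x - h < 0 by lra.
  by rewrite /ppow [0 <= x]leNgt x0 [0 <= x - h]leNgt xh0 /= mulr0 subr0 lexx.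
have key := @subrXX_bounds p x.
have [y0|y0] := ltP (x - h) 0.
  have /andP[_ k2] := key 0 (lexx 0) x0.
  rewrite /ppow x0 [0 <= x - h]leNgt y0 /= mulr0 subr0 mulr_ge0 ?exprn_ge0 //=.
  rewrite eE !mulrA; apply: ler_wpM2r => //.
  move: k2; rewrite expr0n !subr0 => /le_trans; apply.
  have -> : h * x ^+ p * p.+1%:R = p.+1%:R * x ^+ p * h by ring.
  by rewrite ler_wpM2l ?mulr_ge0 ?exprn_ge0 //; lra.
have yx : x - h <= x by lra.
have /andP[k1 k2] := key _ y0 yx.
rewrite /ppow x0 y0 eE -mulrBl; apply/andP; split.
  rewrite !mulrA; apply: ler_wpM2r => //; move: k1.
  by congr (_ <= _); ring.
rewrite !mulrA; apply: ler_wpM2r => //; move: k2.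
by congr (_ <= _); ring.
Qed.

End growth.

(** * Sums along a random walk with positive steps *)

Section walk.
Context {d : measure_display} {Omega : measurableType d} {R : realType}
  (P : probability Omega R) (xi : nat -> Omega -> R).
Local Notation Ex X := (Rintegral P setT X).
Local Notation others k := (g_sigma_algebraType (other_cylinders xi k)).

(** The steps are positive everywhere, and not only almost surely, so that the
    inequalities between sums along the walk hold pointwise. *)
Definition positive_iid : Prop :=
  [/\ forall k, measurable_fun [set: Omega] (xi k),
      forall k w, 0 < xi k w,
      forall k, identically_distributed P (xi k) (xi 0%N),
      mutually_independent P xi &
      int2 P (xi 0%N)].

Hypothesis iid : positive_iid.

Let mxi k : measurable_fun [set: Omega] (xi k).
Proof. by case: iid. Qed.

Let xi_gt0 k w : 0 < xi k w.
Proof. by case: iid. Qed.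

Let idxi k : identically_distributed P (xi k) (xi 0%N).
Proof. by case: iid. Qed.

Let indxi : mutually_independent P xi.
Proof. by case: iid. Qed.

Let xi2 : int2 P (xi 0%N).
Proof. by case: iid. Qed.

Definition walk n w := \sum_(k < n) xi k w.
Local Notation S := walk.

Definition step_mean := Ex (xi 0%N).
Definition step_var := Ex (fun w => (xi 0%N w - step_mean) ^+ 2).
Local Notation m := step_mean.

Lemma walkS n w : S n.+1 w = S n w + xi n w.
Proof. by rewrite /walk big_ord_recr. Qed.

Lemma walk0 w : S 0 w = 0.
Proof. by rewrite /walk big_ord0. Qed.

Lemma walk_ge0 n w : 0 <= S n w.
Proof. by apply: sumr_ge0 => k _; exact: ltW. Qed.

Lemma measurable_walk n : measurable_fun [set: Omega] (S n).
Proof. by apply: measurable_sum => k; exact: mxi. Qed.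

Lemma measurable_walk_others n : measurable_fun [set: others n] (S n : others n -> R).
Proof.
apply: (@measurable_sum _ (others n)) => k; apply: measurable_others.
by rewrite ltn_eqF.
Qed.

Section bounded_terms.
Variables (f : R -> R) (gf : growth f) (t : R).

Lemma term_bounds k w : 0 <= f (t - S k w) <= f t.
Proof.
rewrite (growth_ge0 _ gf) /=; case: gf => ndf _.
by apply: ndf; rewrite gerBl walk_ge0.
Qed.

Lemma measurable_term k : measurable_fun [set: Omega] (fun w => f (t - S k w)).
Proof.
apply: (measurableT_comp (growth_measurable gf)).
by apply: measurable_funB => //; exact: measurable_walk.
Qed.

Lemma measurable_term_others k :
  measurable_fun [set: others k] (fun w : others k => f (t - S k w)).
Proof.
apply: (measurableT_comp (growth_measurable gf)).
by apply: measurable_funB => //; exact: measurable_walk_others.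
Qed.

Lemma int2_term k : int2 P (fun w => f (t - S k w)).
Proof.
apply: (@int2_bounded _ _ _ _ _ (f t)); first exact: measurable_term.
by move=> w; have /andP[h1 h2] := term_bounds k w; rewrite ger0_norm.
Qed.

Lemma int1_term k : int1 P (fun w => f (t - S k w)).
Proof. exact/int2_int1/int2_term. Qed.

End bounded_terms.

(** All steps have the same law. *)
Lemma int1_xi (phi : R -> R) k : measurable_fun [set: R] phi ->
  (forall x, 0 <= phi x) -> int1 P (fun w => phi (xi 0%N w)) ->
  int1 P (fun w => phi (xi k w)) /\
  Ex (fun w => phi (xi k w)) = Ex (fun w => phi (xi 0%N w)).
Proof.
move=> mphi phi0 iphi.
have E : (\int[P]_w (phi (xi k w))%:E = \int[P]_w (phi (xi 0%N w))%:E)%E.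
  apply: (@integral_identically_distributed _ _ _ _ _ _ (xi k) (xi 0%N)
    (fun x => (phi x)%:E)) => //.
  exact/measurable_EFinP.
split; last by rewrite /Rintegral E.
apply/integrableP; split.
  by apply/measurable_EFinP; exact: measurableT_comp.
under eq_integral => w _ do rewrite /= ger0_norm //.
by rewrite E -EFin_Ex // ltry.
Qed.

(** The step [xi k] is independent of anything that ignores it, in particular of
    the positions [S_0, ..., S_k]. *)
Lemma xi_product (phi : R -> R) k (W : others k -> R) :
  measurable_fun [set: R] phi -> (forall x, 0 <= phi x) ->
  int1 P (fun w => phi (xi 0%N w)) ->
  measurable_fun [set: others k] W -> int1 P W ->
  int1 P (fun w => phi (xi k w) * W w) /\
  Ex (fun w => phi (xi k w) * W w) = Ex (fun w => phi (xi 0%N w)) * Ex W.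
Proof.
move=> mphi phi0 iphi mW iW; have [ik Ek] := int1_xi k mphi phi0 iphi.
have [i1 E1] := independent_product mxi indxi mphi phi0 ik mW iW.
by rewrite E1 Ek.
Qed.

Lemma measurable_normr_R : measurable_fun [set: R] (@Num.norm R R).
Proof. exact: normr_measurable. Qed.

Lemma normr_xi k w : `|xi k w| = xi k w.
Proof. by rewrite gtr0_norm. Qed.

Lemma int1_normr_xi : int1 P (fun w => `|xi 0%N w|).
Proof. exact: (integrable_norm (int2_int1 xi2)). Qed.

Lemma xi_mean_product k (W : others k -> R) :
  measurable_fun [set: others k] W -> int1 P W ->
  int1 P (fun w => xi k w * W w) /\ Ex (fun w => xi k w * W w) = m * Ex W.
Proof.
move=> mW iW.
have := xi_product measurable_normr_R (@normr_ge0 _ _) int1_normr_xi mW iW.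
have -> : (fun w => `|xi 0%N w|) = xi 0%N.
  by apply/funext => w; rewrite normr_xi.
have -> : (fun w => `|xi k w| * W w) = (fun w => xi k w * W w).
  by apply/funext => w; rewrite normr_xi.
by [].
Qed.

Definition tail_sqr (K x : R) : R := if K < x then x ^+ 2 else 0.

Lemma tail_sqr_ge0 K x : 0 <= tail_sqr K x.
Proof. by rewrite /tail_sqr; case: ifP => // _; exact: sqr_ge0. Qed.

Lemma measurable_tail_sqr K : measurable_fun [set: R] (tail_sqr K).
Proof.
apply: measurable_fun_ifT => //; first exact: measurable_fun_ltr.
Qed.

Lemma int1_tail_sqr K : int1 P (fun w => tail_sqr K (xi 0%N w)).
Proof.
case: xi2 => m0 i0; apply: int1_le i0.
  exact: (measurableT_comp (measurable_tail_sqr K) (mxi 0)).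
move=> w; rewrite ger0_norm ?tail_sqr_ge0 // /tail_sqr.
by case: ifP => // _; exact: sqr_ge0.
Qed.

Definition tail_moment K := Ex (fun w => tail_sqr K (xi 0%N w)).

(** Dominated convergence, with the square of a step as dominating function. *)
Lemma tail_moment_cvg0 : tail_moment n%:R @[n --> \oo] --> 0.
Proof.
have h := @dominated_cvg _ _ _ P setT measurableT
  (fun n w => (tail_sqr n%:R (xi 0%N w))%:E) (fun=> 0%E)
  (fun w => (xi 0%N w ^+ 2)%:E).
apply: fine_cvg.
have -> : 0%:E = (\int[P]_(w in setT) (cst 0 w))%E by rewrite integral0.
apply: h => //.
- move=> n; apply/measurable_EFinP.
  exact: (measurableT_comp (measurable_tail_sqr _) (mxi 0)).
- move=> w _; apply: cvg_near_cst; near=> n.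
  rewrite /tail_sqr ltNge (_ : xi 0%N w <= n%:R) //.
  by near: n; exact: nbhs_infty_ger.
- by case: xi2.
- move=> n w _; rewrite /= lee_fin ger0_norm ?tail_sqr_ge0 // /tail_sqr.
  by case: ifP => // _; exact: sqr_ge0.
Unshelve. all: by end_near. Qed.

(** A nonnegative function with zero integral vanishes almost everywhere, and the
    steps vanish nowhere. *)
Lemma mean_gt0 : 0 < m.
Proof.
have i1 := int2_int1 xi2; have m0 : 0 <= m by apply: Ex_ge0 => w; exact: ltW.
rewrite lt_neqAle m0 andbT; apply/eqP => mE.
have : (\int[P]_w `|(xi 0%N w)%:E| = 0)%E.
  under eq_integral => w _ do rewrite gee0_abs ?lee_fin ?ltW //.
  by rewrite -EFin_Ex // -/m -mE.
move/(ae_eq_integral_abs P measurableT _).1 => /(_ _)[|N [mN PN NE]].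
  exact/measurable_EFinP.
have NT : N = setT.
  apply/seteqP; split => // w _; apply: NE => /= /(_ I) [] xi0.
  by have := xi_gt0 0 w; rewrite xi0 ltxx.
have := probability_setT P; rewrite -NT => P1.
by move: (etrans (esym P1) PN) => /eqP; rewrite onee_eq0.
Qed.

Local Notation step := (ppow 0).

Definition renewal_sum n (f : R -> R) (t : R) :=
  \sum_(k < n) Ex (fun w => f (t - S k w)).
Local Notation U := renewal_sum.

Definition term_sum n (f : R -> R) (t : R) w := \sum_(k < n) f (t - S k w).

(** The upper Riemann sum of [f (t - .)] along the mesh [S_0 < S_1 < ...]. *)
Definition weighted_sum n (f : R -> R) (t : R) w :=
  \sum_(k < n) xi k w * f (t - S k w).
Local Notation A := weighted_sum.

Definition riemann_error n (f G : R -> R) (t : R) w :=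
  A n f t w - (G t - G (t - S n w)).
Local Notation Err := riemann_error.

(** A majorant of the squares of the steps begun before [t]: those below [K] are
    bounded by [K], and the sum of the others replaces their maximum. *)
Definition max_sqr K n t w : R :=
  K ^+ 2 + \sum_(k < n) tail_sqr K (xi k w) * step (t - S k w).

Lemma tail_term_ge0 K k t w : 0 <= tail_sqr K (xi k w) * step (t - S k w).
Proof. by rewrite mulr_ge0 ?tail_sqr_ge0 ?(growth_ge0 _ (growth_ppow 0)). Qed.

Lemma le_max_sqr K n t w k : 0 <= K -> (k < n)%N -> 0 <= t - S k w ->
  xi k w <= Num.sqrt (max_sqr K n t w).
Proof.
move=> K0 kn tk; rewrite -[leLHS]normr_xi -sqrtr_sqr; apply: ler_wsqrtr.
rewrite /max_sqr (bigD1 (Ordinal kn)) //= ppow0 // mulr1 addrA.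
rewrite ler_wpDr ?sumr_ge0 // => [i _|]; first exact: tail_term_ge0.
rewrite /tail_sqr; case: ltP => xK; first by rewrite ler_wpDl ?sqr_ge0.
by rewrite addr0 lerXn2r ?nnegrE // ltW.
Qed.

(** The [k]-th rectangle exceeds the integral by at most
    [xi_k * (f (t - S_k) - f (t - S_(k+1)))]; bounding [xi_k] by the largest step,
    the remaining sum telescopes to at most [f t]. *)
Lemma riemann_error_bounds K n f G t w : primitive f G -> 0 <= K ->
  0 <= Err n f G t w <= Num.sqrt (max_sqr K n t w) * f t.
Proof.
move=> [gf gG fG] K0; set M := Num.sqrt _.
suff H n' : (n' <= n)%N ->
    0 <= Err n' f G t w <= M * (f t - f (t - S n' w)).
  have /andP[-> h2] := H n (leqnn n); apply: (le_trans h2).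
  rewrite ler_wpM2l ?sqrtr_ge0 // gerBl.
  exact: growth_ge0.
elim: n' => [_|n' IH n'n].
  by rewrite /Err /A big_ord0 walk0 !subr0 !subrr mulr0 lexx.
have /andP[h1 h2] := IH (ltnW n'n).
have EE : Err n'.+1 f G t w = Err n' f G t w + (xi n' w * f (t - S n' w) -
    (G (t - S n' w) - G (t - S n' w - xi n' w))).
  have -> : t - S n' w - xi n' w = t - S n'.+1 w by rewrite walkS opprD addrA.
  by rewrite /Err /A big_ord_recr /=; ring.
have /andP[k1 k2] := fG (t - S n' w) (xi n' w) (ltW (xi_gt0 _ _)).
rewrite EE; set x := t - S n' w in k1 k2 h2 *; set h := xi n' w in k1 k2 *.
have xE : t - S n'.+1 w = x - h by rewrite walkS opprD addrA.
rewrite xE.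
have fx : f (x - h) <= f x.
  by case: gf => ndf _; apply: ndf; rewrite gerBl ltW // xi_gt0.
have hM : h * (f x - f (x - h)) <= M * (f x - f (x - h)).
  have [x0|x0] := ltP x 0.
    have h0 : x - h < 0 by rewrite (le_lt_trans _ x0) // gerBl ltW // xi_gt0.
    by case: gf => _ f0; rewrite !f0 // subr0 !mulr0.
  by rewrite ler_wpM2r ?subr_ge0 //; exact: le_max_sqr.
nra.
Qed.

(** * Moments of the partial sums *)

Lemma int2_xi k : int2 P (xi k).
Proof.
split; first exact: mxi.
have [|||//] := @int1_xi (fun x => x ^+ 2) k.
- exact: measurable_funX.
- by move=> x; exact: sqr_ge0.
- by case: xi2.
Qed.

Lemma int2_xi_term f t k : growth f ->
  int2 P (fun w => xi k w * f (t - S k w)).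
Proof.
move=> gf; apply: (@int2_le _ _ _ _ _ (fun w => f t * xi k w)).
- by apply: measurable_funM => //; exact: measurable_term.
- move=> w; rewrite mulrC !normrM ler_wpM2r //.
  have /andP[h1 h2] := term_bounds gf t k w.
  by rewrite !ger0_norm // (le_trans h1).
- exact/int2Z/int2_xi.
Qed.

Lemma int2_weighted_sum n f t : growth f -> int2 P (A n f t).
Proof.
move=> gf; apply: (@int2_sum _ _ _ _ n (fun k w => xi k w * f (t - S k w))) => k.
exact: int2_xi_term.
Qed.

Lemma int2_term_sum n f t : growth f -> int2 P (term_sum n f t).
Proof.
move=> gf; apply: (@int2_sum _ _ _ _ n (fun k w => f (t - S k w))) => k.
exact: int2_term.
Qed.

Lemma int2_riemann_error n f G t : growth f -> growth G -> int2 P (Err n f G t).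
Proof.
move=> gf gG; apply: int2B; first exact: int2_weighted_sum.
by apply: int2B; [exact: int2_cst|exact: int2_term].
Qed.

Lemma Ex_term_sum n f t : growth f -> Ex (term_sum n f t) = U n f t.
Proof. by move=> gf; exact: (@Ex_sum _ _ _ P n (fun k w => f (t - S k w)) (int1_term gf t)). Qed.

Lemma Ex_weighted_sum n f t : growth f -> Ex (A n f t) = m * U n f t.
Proof.
move=> gf; rewrite (@Ex_sum _ _ _ _ n (fun k w => xi k w * f (t - S k w))) => [|k]; last exact/int2_int1/int2_xi_term.
rewrite mulr_sumr; apply: eq_bigr => k _.
have [] := @xi_mean_product k (fun w => f (t - S k w)) => //.
- exact: measurable_term_others.
- exact: int1_term.
Qed.

Lemma Ex_riemann_error n f G t : growth f -> growth G ->
  Ex (Err n f G t) = m * U n f t - (G t - Ex (fun w => G (t - S n w))).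
Proof.
move=> gf gG; rewrite -Ex_weighted_sum // -[G t in RHS](Ex_cst P (G t)).
have iG := int1_term gG t n.
rewrite -ExB //; last exact: int1_cst.
rewrite -ExB //; first exact/int2_int1/int2_weighted_sum.
by apply: int1B => //; exact: int1_cst.
Qed.

Lemma max_sqr_ge0 K n t w : 0 <= max_sqr K n t w.
Proof. by rewrite addr_ge0 ?sqr_ge0 ?sumr_ge0 // => i _; exact: tail_term_ge0. Qed.

Lemma Ex_max_sqr K n t : int1 P (max_sqr K n t) /\
  Ex (max_sqr K n t) = K ^+ 2 + tail_moment K * U n step t.
Proof.
have H k : int1 P (fun w => tail_sqr K (xi k w) * step (t - S k w)) /\
    Ex (fun w => tail_sqr K (xi k w) * step (t - S k w)) =
    tail_moment K * Ex (fun w => step (t - S k w)).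
  apply: (@xi_product (tail_sqr K) k (fun w => step (t - S k w))).
  - exact: measurable_tail_sqr.
  - exact: tail_sqr_ge0.
  - exact: int1_tail_sqr.
  - exact: (measurable_term_others (growth_ppow 0)).
  - exact: (int1_term (growth_ppow 0)).
have isum := int1_sum n (fun k => (H k).1).
split; first by apply: int1D => //; exact: int1_cst.
rewrite /max_sqr ExD //; last exact: int1_cst.
rewrite Ex_cst (@Ex_sum _ _ _ _ n
  (fun k w => tail_sqr K (xi k w) * step (t - S k w))) => [|k]; last by case: (H k).
by rewrite mulr_sumr; congr +%R; apply: eq_bigr => k _; case: (H k).
Qed.

(** The tail terms of [max_sqr] factor in expectation, since [xi_k] is
    independent of [S_k]. The first moment uses [Num.sqrt M <= 1 + M]. *)
Lemma Ex_riemann_error_le K n f G t : primitive f G -> 0 <= K ->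
  Ex (Err n f G t) <= f t * (1 + (K ^+ 2 + tail_moment K * U n step t)) /\
  Ex (fun w => Err n f G t w ^+ 2) <=
    (f t) ^+ 2 * (K ^+ 2 + tail_moment K * U n step t).
Proof.
move=> pfG K0; have [gf gG _] := pfG.
have ft0 := growth_ge0 t gf.
have [iM EM] := Ex_max_sqr K n t.
have iE := int2_riemann_error n t gf gG.
have i1 : int1 P (fun w => 1 + max_sqr K n t w) by apply: int1D => //; exact: int1_cst.
rewrite -EM; split.
  rewrite -[X in X + _](Ex_cst P 1) -ExD //; last exact: int1_cst.
  rewrite -ExZ //; apply: Ex_le; [exact: int2_int1|exact: int1Z|move=> w].
  have /andP[_ h2] := riemann_error_bounds n t w pfG K0.
  rewrite (le_trans h2) // mulrC ler_wpM2l //.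
  have := sqr_sqrtr (max_sqr_ge0 K n t w).
  have := sqrtr_ge0 (max_sqr K n t w); nra.
rewrite -ExZ //; apply: Ex_le; [by case: iE|exact: int1Z|move=> w].
have /andP[h1 h2] := riemann_error_bounds n t w pfG K0.
rewrite -(sqr_sqrtr (max_sqr_ge0 K n t w)) -exprMn mulrC.
by rewrite lerXn2r ?nnegrE // (le_trans h1).
Qed.

Lemma tail_moment_small (e : R) : 0 < e ->
  exists2 K, 0 <= K & 0 <= tail_moment K <= e.
Proof.
move=> e0; have /cvgrPdist_le /(_ _ e0)[N _ /(_ N (leqnn N))] := tail_moment_cvg0.
rewrite /= sub0r normrN => h; exists N%:R => //.
have t0 : 0 <= tail_moment N%:R by apply: Ex_ge0 => w; exact: tail_sqr_ge0.
by rewrite t0 (le_trans (ler_norm _)).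
Qed.

Lemma renewal_sum_ge0 n f t : growth f -> 0 <= U n f t.
Proof.
move=> gf; apply: sumr_ge0 => k _; apply: Ex_ge0 => w; exact: growth_ge0.
Qed.

(** The case of the indicator, with [K] so large that the tail moment is at most
    [m / 2]: the expected number of visits appears on both sides with the smaller
    factor on the right. *)
Lemma renewal_sum_step_le : exists2 C, 0 <= C &
  forall n t, 0 <= t -> U n step t <= C * (1 + t).
Proof.
have m0 := mean_gt0.
have [|K K0 /andP[d0 dK]] := @tail_moment_small (m / 2); first by rewrite divr_gt0.
exists (2 / m * (1 + K ^+ 2)).
  by rewrite mulr_ge0 ?divr_ge0 ?addr_ge0 ?sqr_ge0 // ltW.
move=> n t t0.
have p := @primitive_ppow R 0; have [gf gG _] := p.
have [] := Ex_riemann_error_le n t p K0; rewrite Ex_riemann_error // => h _.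
have G0 : 0 <= Ex (fun w => ppow 1 (t - S n w)).
  by apply: Ex_ge0 => w; exact: growth_ge0.
move: h; rewrite ppow1 // ppow0 // mul1r => h.
have U0 := renewal_sum_ge0 n t gf.
have K2 := sqr_ge0 K.
(* [h] reads [m * U <= t + 1 + K ^+ 2 + tail_moment K * U], with tail moment at
   most [m / 2]. *)
have h2 : m / 2 * U n step t <= 1 + K ^+ 2 + t by nra.
have -> : 2 / m * (1 + K ^+ 2) * (1 + t) = (m / 2)^-1 * ((1 + K ^+ 2) * (1 + t)).
  by rewrite invf_div; ring.
rewrite ler_pdivlMl ?divr_gt0 // (le_trans h2) //; nra.
Qed.

(** The number of visits is at most linear in [t] and the tail moment is
    arbitrarily small, so the second moment of the largest step is [o(t)]; the
    bounds are uniform in the number [n] of terms. *)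
Lemma Ex_riemann_error_small (e : R) : 0 < e -> exists2 C, 0 <= C &
  forall n f G t, 0 <= t -> primitive f G ->
  Ex (Err n f G t) <= f t * (e * t + C) /\
  Ex (fun w => Err n f G t w ^+ 2) <= (f t) ^+ 2 * (e * t + C).
Proof.
move=> e0; have [C C0 UC] := renewal_sum_step_le.
(* The number of visits is at most [C * (1 + t)], so this [K] makes its product
   with the tail moment at most [e * (1 + t)]. *)
have [|K K0 /andP[d0 dK]] := @tail_moment_small (e / (1 + C)).
  by rewrite divr_gt0 // ltr_pwDl.
exists (1 + (K ^+ 2 + e)); first by rewrite !addr_ge0 ?sqr_ge0 // ltW.
move=> n f G t t0 pfG; have [gf gG _] := pfG.
have ft0 := growth_ge0 t gf.
have U0 := renewal_sum_ge0 n t (growth_ppow 0).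
have h : tail_moment K * U n step t <= e * t + e.
  have -> : e * t + e = e / (1 + C) * ((1 + C) * (1 + t)).
    by field; rewrite gt_eqF // ltr_pwDl.
  apply: ler_pM => //; apply: (le_trans (UC n t t0)).
  by rewrite ler_wpM2r ?addr_ge0 // lerDr.
have [h1 h2] := Ex_riemann_error_le n t pfG K0.
split.
  by rewrite (le_trans h1) // ler_wpM2l //; lra.
by rewrite (le_trans h2) // ler_wpM2l ?sqr_ge0 //; lra.
Qed.

(** The martingale part of [m] times the sum of [f (t - S_k)]. *)
Definition centered_sum n (f : R -> R) (t : R) w :=
  \sum_(k < n) (m - xi k w) * f (t - S k w).
Local Notation Y := centered_sum.

Lemma centered_sumE n f t w : Y n f t w = m * term_sum n f t w - A n f t w.
Proof.
rewrite /Y /term_sum /A mulr_sumr -sumrB; apply: eq_bigr => k _.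
by rewrite mulrBl.
Qed.

Lemma int2_centered_sum n f t : growth f -> int2 P (Y n f t).
Proof.
move=> gf; have := int2B (int2Z m (int2_term_sum n t gf)) (int2_weighted_sum n t gf).
by congr int2; apply/funext => w; rewrite centered_sumE.
Qed.

Lemma Ex_centered_sum n f t : growth f -> Ex (Y n f t) = 0.
Proof.
move=> gf; have -> : Y n f t = (fun w => m * term_sum n f t w - A n f t w).
  by apply/funext => w; rewrite centered_sumE.
have i1 := int2_int1 (int2_term_sum n t gf).
rewrite ExB ?ExZ ?Ex_term_sum ?Ex_weighted_sum ?subrr //.
- exact: int1Z.
- exact/int2_int1/int2_weighted_sum.
Qed.

Lemma measurable_centered_sum_others n f t : growth f ->
  measurable_fun [set: others n] (Y n f t : others n -> R).
Proof.
move=> gf; apply: (@measurable_sum _ (others n)) => k.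
have kn : (k < n)%N by [].
apply: measurable_funM.
  by apply: measurable_funB => //; apply: measurable_others; rewrite ltn_eqF.
apply: (measurableT_comp (growth_measurable gf)).
apply: measurable_funB => //; apply: (@measurable_sum _ (others n)) => i.
by apply: measurable_others; rewrite ltn_eqF // (ltn_trans _ kn).
Qed.

(** Orthogonality of martingale differences: [xi_n] is independent of the earlier
    sum and of [S_n], so the mixed term vanishes and the new square contributes the
    factor [step_var]. *)
Lemma Ex_centered_sum_sqr n f t : growth f ->
  Ex (fun w => Y n f t w ^+ 2) = step_var * U n (fun x => f x * f x) t.
Proof.
move=> gf; elim: n => [|n IH].
  rewrite /U big_ord0 mulr0 -[RHS](Ex_cst P 0); apply: eq_Rintegral => w _.
  by rewrite /Y big_ord0 expr0n.
pose c w := f (t - S n w).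
have mc : measurable_fun [set: others n] (c : others n -> R).
  exact: measurable_term_others.
have ic : int2 P c by exact: int2_term.
have iY := int2_centered_sum n t gf.
pose W w := c w * Y n f t w.
have mW : measurable_fun [set: others n] (W : others n -> R).
  by apply: measurable_funM => //; exact: measurable_centered_sum_others.
have iW : int1 P W by exact: int1M.
have [iXW EXW] := xi_mean_product mW iW.
have mcc : measurable_fun [set: others n] ((fun w => c w * c w) : others n -> R).
  exact: measurable_funM.
have icc : int1 P (fun w => c w * c w) by exact: int1M.
have [|||iV EV] := @xi_product (fun x => (x - m) ^+ 2) n _ _ _ _ mcc icc.
- by apply: measurable_funX; exact: measurable_funB.
- by move=> x; exact: sqr_ge0.
- by case: (int2B xi2 (int2_cst P m)).
have -> : Ex (fun w => Y n.+1 f t w ^+ 2) =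
    Ex (fun w => (Y n f t w ^+ 2 + 2 * (m * W w - xi n w * W w)) +
                 (xi n w - m) ^+ 2 * (c w * c w)).
  apply: eq_Rintegral => w _; rewrite /W /c {1}/Y big_ord_recr /= -/(Y n f t w).
  by ring.
have iD : int1 P (fun w => m * W w - xi n w * W w) by apply: int1B => //; exact: int1Z.
have iYY : int1 P (fun w => Y n f t w ^+ 2) by case: iY.
rewrite ExD //; last by apply: int1D => //; exact: int1Z.
rewrite ExD //; last exact: int1Z.
rewrite ExZ // ExB //; last exact: int1Z.
rewrite ExZ // EXW subrr mulr0 addr0 EV IH -mulrDr; congr *%R.
by rewrite /U big_ord_recr.
Qed.

(** * Infinite sums and their expectation *)

Lemma lim_le (u v : R ^nat) (l l' : R) :
  u n @[n --> \oo] --> l -> v n @[n --> \oo] --> l' ->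
  (forall n, u n <= v n) -> l <= l'.
Proof. by move=> ul vl uv; apply: (ler_cvg_to ul vl); apply: nearW. Qed.

Lemma growth_neg_term f t k w : growth f -> t < 0 -> f (t - S k w) = 0.
Proof. by case=> _ f0 t0; apply: f0; rewrite (le_lt_trans _ t0) // gerBl walk_ge0. Qed.

Lemma renewal_sum_neg n f t : growth f -> t < 0 -> U n f t = 0.
Proof.
move=> gf t0; rewrite /U big1 // => k _; rewrite -[RHS](Ex_cst P 0).
by apply: eq_Rintegral => w _; exact: growth_neg_term.
Qed.

Lemma term_le_step f t k w : growth f -> f (t - S k w) <= f t * step (t - S k w).
Proof.
move=> gf; have [t0|t0] := ltP (t - S k w) 0.
  by case: (gf) (growth_ppow (R:=R) 0) => _ -> // [_ ->] //; rewrite mulr0.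
by rewrite ppow0 // mulr1; case/andP: (term_bounds gf t k w).
Qed.

Lemma renewal_sum_le n f t : growth f -> U n f t <= f t * U n step t.
Proof.
move=> gf; rewrite /U mulr_sumr; apply: ler_sum => k _.
have ist := int1_term (growth_ppow 0) t k.
rewrite -ExZ //; apply: Ex_le; [exact: int1_term|exact: int1Z|move=> w].
exact: term_le_step.
Qed.

Lemma renewal_sum_nd f t : growth f ->
  {homo (fun n => U n f t) : n n' / (n <= n')%N >-> n <= n'}.
Proof.
move=> gf; apply/nondecreasing_seqP => n; rewrite /U big_ord_recr /= lerDl.
by apply: Ex_ge0 => w; exact: growth_ge0.
Qed.

(** For the indicator of the half-line this is the renewal function. *)
Definition renewal (f : R -> R) (t : R) : R := limn (fun n => U n f t).

Lemma cvg_renewal_sum f t : growth f -> U n f t @[n --> \oo] --> renewal f t.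
Proof.
move=> gf; apply: nondecreasing_is_cvgn; first exact: renewal_sum_nd.
have [C C0 UC] := renewal_sum_step_le.
exists (f t * (C * (1 + `|t|))) => _ [n _ <-].
have [t0|t0] := ltP t 0.
  by rewrite renewal_sum_neg // mulr_ge0 ?(growth_ge0 _ gf) // mulr_ge0 // addr_ge0.
rewrite (le_trans (renewal_sum_le n t gf)) // ler_wpM2l ?(growth_ge0 _ gf) //.
by rewrite ger0_norm //; exact: UC.
Qed.

Lemma renewal_sum_le_lim n f t : growth f -> U n f t <= renewal f t.
Proof.
move=> gf; apply: nondecreasing_cvgn_le; first exact: renewal_sum_nd.
by apply/cvg_ex; exists (renewal f t); exact: cvg_renewal_sum.
Qed.

Lemma renewal_ge0 f t : growth f -> 0 <= renewal f t.
Proof.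
by move=> gf; rewrite (le_trans _ (renewal_sum_le_lim 0 t gf)) // renewal_sum_ge0.
Qed.

(** These are the terms of a convergent series. *)
Lemma Ex_term_cvg0 f t : growth f ->
  Ex (fun w => f (t - S n w)) @[n --> \oo] --> 0.
Proof.
move=> gf; have h := cvg_renewal_sum (t := t) gf.
have h1 : U n.+1 f t @[n --> \oo] --> renewal f t.
  by have := cvg_shiftS (fun n => U n f t) (nbhs (renewal f t)) => ->.
have -> : (fun n => Ex (fun w => f (t - S n w))) = (fun n => U n.+1 f t - U n f t).
  by apply/funext => n; rewrite /U big_ord_recr /= addrAC subrr add0r.
by rewrite -[X in _ --> X](subrr (renewal f t)); exact: cvgB h1 h.
Qed.

Lemma renewal_step_le : exists2 C, 0 <= C &
  forall t, 0 <= t -> renewal step t <= C * (1 + t).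
Proof.
have [C C0 UC] := renewal_sum_step_le; exists C => // t t0.
apply: (lim_le (cvg_renewal_sum (t := t) (growth_ppow 0)) (cvg_cst _)) => n.
exact: UC.
Qed.

Lemma renewal_le f t : growth f -> renewal f t <= f t * renewal step t.
Proof.
move=> gf; apply: (lim_le (cvg_renewal_sum (t := t) gf)
  (cvgM (cvg_cst (f t)) (cvg_renewal_sum (t := t) (growth_ppow 0)))) => n.
exact: renewal_sum_le.
Qed.

Lemma renewal_le_comb (a b c : R) f g h t : growth f -> growth g -> growth h ->
  (forall x, b * f x <= a * g x + c * h x) ->
  b * renewal f t <= a * renewal g t + c * renewal h t.
Proof.
move=> gf gg gh fgh.
apply: (lim_le (cvgM (cvg_cst b) (cvg_renewal_sum (t := t) gf))
  (cvgD (cvgM (cvg_cst a) (cvg_renewal_sum (t := t) gg))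
        (cvgM (cvg_cst c) (cvg_renewal_sum (t := t) gh)))) => n /=.
rewrite /U !mulr_sumr -big_split; apply: ler_sum => k _ /=.
have iF := int1_term gf t k; have iG := int1_term gg t k.
have iH := int1_term gh t k.
rewrite -!ExZ // -ExD; [|exact: int1Z|exact: int1Z].
by apply: Ex_le => //; [exact: int1Z|apply: int1D; exact: int1Z].
Qed.

(** The mean of the decomposition into martingale part and Riemann sum; for the
    indicator this contains the elementary renewal theorem. *)
Lemma renewal_primitive (e : R) : 0 < e -> exists2 C, 0 <= C &
  forall f G t, 0 <= t -> primitive f G ->
  G t <= m * renewal f t <= G t + f t * (e * t + C).
Proof.
move=> e0; have [C C0 HC] := Ex_riemann_error_small e0.
exists C => // f G t t0 pfG; have [gf gG _] := pfG.
have mU : m * U n f t @[n --> \oo] --> m * renewal f t.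
  exact: cvgM (cvg_cst _) (cvg_renewal_sum (t := t) gf).
apply/andP; split.
  have hG : G t - Ex (fun w => G (t - S n w)) @[n --> \oo] --> G t.
    rewrite -[X in _ --> X]subr0.
    by apply: cvgB; [exact: cvg_cst|exact: Ex_term_cvg0].
  apply: (lim_le hG mU) => n; rewrite -subr_ge0 -Ex_riemann_error //.
  apply: Ex_ge0 => w.
  by have /andP[] := riemann_error_bounds n t w pfG (lexx 0).
apply: (lim_le mU (cvg_cst _)) => n.
have [h _] := HC n f G t t0 pfG; move: h; rewrite Ex_riemann_error //.
have : 0 <= Ex (fun w => G (t - S n w)) by apply: Ex_ge0 => w; exact: growth_ge0.
lra.
Qed.

Definition sum_var n f t := Ex (fun w => term_sum n f t w ^+ 2) - (U n f t) ^+ 2.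

(** [m * term_sum] differs from the martingale part [Y] by a constant and by an
    error [B] that is small in [L^2], so its variance is comparable with the second
    moment of [Y]. For the reverse bound [Y] is the difference of the centered
    variables [Q] and [B]. *)
Lemma sum_var_bounds n (eta : R) f G t : 0 < eta -> primitive f G ->
  let r := (1 + eta^-1) * (2 * Ex (fun w => Err n f G t w ^+ 2) +
                           2 * Ex (fun w => G (t - S n w) * G (t - S n w))) in
  m ^+ 2 * sum_var n f t <= (1 + eta) * (step_var * U n (fun x => f x * f x) t) + r /\
  step_var * U n (fun x => f x * f x) t <= (1 + eta) * (m ^+ 2 * sum_var n f t) + r.
Proof.
move=> eta0 [gf gG pfG] r.
(* [G (t - S n)] is the part of the integral that [n] steps do not reach. *)
pose B w := Err n f G t w - G (t - S n w).
pose Q w := Y n f t w + B w.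
have iE := int2_riemann_error n t gf gG.
have iG := int2_term gG t n.
have iY := int2_centered_sum n t gf.
have iB : int2 P B by exact: int2B.
have iQ : int2 P Q by exact: int2D.
have iX := int2_term_sum n t gf.
have eta1 : 0 <= 1 + eta^-1 by rewrite addr_ge0 // invr_ge0 ltW.
have EB : (1 + eta^-1) * Ex (fun w => B w ^+ 2) <= r.
  rewrite ler_wpM2l //.
  have := Ex_sqrD_le ltr01 iE (int2Z (-1) iG).
  rewrite invr1 -[1 + 1]/2%:R.
  have -> : (fun w => (Err n f G t w + -1 * G (t - S n w)) ^+ 2) = (fun w => B w ^+ 2).
    by apply/funext => w; rewrite mulN1r.
  have -> // : (fun w => (-1 * G (t - S n w)) ^+ 2) =
     (fun w => G (t - S n w) * G (t - S n w)).
  by apply/funext => w; rewrite mulN1r sqrrN expr2.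
have QE : Q = (fun w => m * term_sum n f t w - G t).
  by apply/funext => w; rewrite /Q /B centered_sumE /Err; ring.
have i1X := int2_int1 iX; have i1B := int2_int1 iB.
have i1Y := int2_int1 iY; have i1Q := int2_int1 iQ.
have EQ : Ex Q = m * U n f t - G t.
  rewrite QE ExB; [|exact: int1Z|exact: int1_cst].
  by rewrite ExZ // Ex_term_sum // Ex_cst.
have EQB : Ex Q = Ex B by rewrite ExD // Ex_centered_sum // add0r.
have VQ : Ex (fun w => (Q w - Ex Q) ^+ 2) = m ^+ 2 * sum_var n f t.
  have -> : (fun w => (Q w - Ex Q) ^+ 2) =
      (fun w => m ^+ 2 * (term_sum n f t w - Ex (term_sum n f t)) ^+ 2).
    apply/funext => w; rewrite EQ Ex_term_sum // {1}QE; ring.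
  rewrite ExZ; last by case: (int2B iX (int2_cst P (Ex (term_sum n f t)))).
  by rewrite Ex_sqr_centered // Ex_term_sum.
have VQ2 : m ^+ 2 * sum_var n f t = Ex (fun w => Q w ^+ 2) - (Ex Q) ^+ 2.
  by rewrite -VQ Ex_sqr_centered.
have VY := Ex_centered_sum_sqr n t gf.
split.
  rewrite -VY VQ2; have h := Ex_sqrD_le eta0 iY iB.
  have := sqr_ge0 (Ex Q); rewrite -/(Q _) in h *; lra.
rewrite -VY -VQ.
have ic1 : int2 P (fun w => Q w - Ex Q) by apply: int2B => //; exact: int2_cst.
have ic2 : int2 P (fun w => B w - Ex B) by apply: int2B => //; exact: int2_cst.
have := Ex_sqrD_le eta0 ic1 (int2Z (-1) ic2).
have -> : (fun w => (Q w - Ex Q + -1 * (B w - Ex B)) ^+ 2) = (fun w => Y n f t w ^+ 2).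
  by apply/funext => w; rewrite EQB /Q; ring.
have -> : (fun w => (-1 * (B w - Ex B)) ^+ 2) = (fun w => (B w - Ex B) ^+ 2).
  by apply/funext => w; rewrite mulN1r sqrrN.
rewrite (Ex_sqr_centered iB) => h.
apply: (le_trans h); rewrite lerD2l; apply: le_trans EB.
by rewrite ler_wpM2l // gerBl sqr_ge0.
Qed.

(** * Variance of the sum over one litter *)

Lemma term_sum_ge0 n f t w : growth f -> 0 <= term_sum n f t w.
Proof. by move=> gf; apply: sumr_ge0 => k _; exact: growth_ge0. Qed.

Lemma sqr_term_sum_nd f t : growth f ->
  {homo (fun n => Ex (fun w => term_sum n f t w ^+ 2)) : n n' / (n <= n')%N >-> n <= n'}.
Proof.
move=> gf; apply/nondecreasing_seqP => n.
have [_ i1] := int2_term_sum n t gf; have [_ i2] := int2_term_sum n.+1 t gf.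
apply: Ex_le => // w.
rewrite lerXn2r ?nnegrE ?term_sum_ge0 //.
by rewrite /term_sum big_ord_recr /= lerDl growth_ge0.
Qed.

Definition second_moment f t : R := limn (fun n => Ex (fun w => term_sum n f t w ^+ 2)).

Definition renewal_var f t := second_moment f t - (renewal f t) ^+ 2.

Lemma Ex_term_sqr_le n f t : growth f ->
  Ex (fun w => f (t - S n w) * f (t - S n w)) <= f t * f t.
Proof.
move=> gf; rewrite -[leRHS](Ex_cst P); apply: Ex_le.
- exact: (int1_term (growthM gf gf) t n).
- exact: int1_cst.
- by move=> w; have /andP[h1 h2] := term_bounds gf t n w; rewrite ler_pM.
Qed.

Lemma var_ge0 : 0 <= step_var.
Proof. by apply: Ex_ge0 => w; exact: sqr_ge0. Qed.

Lemma term_sum_neg n f t w : growth f -> t < 0 -> term_sum n f t w = 0.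
Proof.
by move=> gf t0; rewrite /term_sum big1 // => k _; exact: growth_neg_term.
Qed.

(** Monotone in [n]; bounded because [sum_var_bounds] bounds the variances and the
    means converge. *)
Lemma cvg_second_moment f G t : primitive f G ->
  Ex (fun w => term_sum n f t w ^+ 2) @[n --> \oo] --> second_moment f t.
Proof.
move=> pfG; have [gf gG _] := pfG; have gff := growthM gf gf.
apply: nondecreasing_is_cvgn; first exact: sqr_term_sum_nd.
have [t0|t0] := ltP t 0.
  exists 0 => _ [n _ <-]; rewrite -[leRHS](Ex_cst P).
  have -> // : (fun w => term_sum n f t w ^+ 2) = (fun=> 0).
  by apply/funext => w; rewrite term_sum_neg // expr0n.
have [C C0 HC] := Ex_riemann_error_small ltr01.
have m2 : 0 < m ^+ 2 by rewrite exprn_gt0 // mean_gt0.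
pose b := 2 * (step_var * renewal (fun x => f x * f x) t) +
  2 * (2 * ((f t) ^+ 2 * (1 * t + C)) + 2 * (G t * G t)).
exists (b / m ^+ 2 + (renewal f t) ^+ 2) => _ [n _ <-].
have [h _] := sum_var_bounds n t ltr01 pfG.
rewrite invr1 in h; set r := (1 + 1) * _ in h.
have [_ h1] := HC n f G t t0 pfG.
have h2 := Ex_term_sqr_le n t gG.
have h3 := ler_wpM2l var_ge0 (renewal_sum_le_lim n t gff).
have h4 : m ^+ 2 * sum_var n f t <= b.
  apply: (le_trans h); rewrite /b /r; lra.
have h5 : sum_var n f t <= b / m ^+ 2 by rewrite ler_pdivlMr // mulrC.
have h6 : (U n f t) ^+ 2 <= (renewal f t) ^+ 2.
  by rewrite lerXn2r ?nnegrE ?renewal_sum_ge0 ?renewal_ge0 // renewal_sum_le_lim.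
by move: h5; rewrite /sum_var; lra.
Qed.

Lemma cvg_sum_var f G t : primitive f G ->
  sum_var n f t @[n --> \oo] --> renewal_var f t.
Proof.
move=> pfG; have [gf gG _] := pfG.
apply: cvgB; first exact: cvg_second_moment pfG.
rewrite expr2; under eq_fun do rewrite expr2.
by apply: cvgM; exact: cvg_renewal_sum.
Qed.

(** [sum_var_bounds] in the limit: the boundary term [G (t - S_n)] disappears. *)
Lemma renewal_var_bounds (e : R) : 0 < e -> exists2 C, 0 <= C &
  forall eta f G t, 0 < eta -> 0 <= t -> primitive f G ->
  let r := (1 + eta^-1) * (2 * ((f t) ^+ 2 * (e * t + C))) in
  m ^+ 2 * renewal_var f t <= (1 + eta) * (step_var * renewal (fun x => f x * f x) t) + r /\
  step_var * renewal (fun x => f x * f x) t <= (1 + eta) * (m ^+ 2 * renewal_var f t) + r.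
Proof.
move=> e0; have [C C0 HC] := Ex_riemann_error_small e0.
exists C => // eta f G t eta0 t0 pfG r; have [gf gG _] := pfG.
have gff := growthM gf gf; have gGG := growthM gG gG.
have eta1 : 0 <= 1 + eta^-1 by rewrite addr_ge0 // invr_ge0 ltW.
pose rn n := (1 + eta^-1) * (2 * ((f t) ^+ 2 * (e * t + C)) +
  2 * Ex (fun w => G (t - S n w) * G (t - S n w))).
have crn : rn n @[n --> \oo] --> r.
  have -> : r = (1 + eta^-1) * (2 * ((f t) ^+ 2 * (e * t + C)) + 2 * 0).
    by rewrite /r mulr0 addr0.
  apply: cvgM; first exact: cvg_cst.
  apply: cvgD; first exact: cvg_cst.
  by apply: cvgM; [exact: cvg_cst|exact: (@Ex_term_cvg0 (fun x => G x * G x) t gGG)].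
have cv : m ^+ 2 * sum_var n f t @[n --> \oo] --> m ^+ 2 * renewal_var f t.
  by apply: cvgM; [exact: cvg_cst|exact: cvg_sum_var pfG].
have cU : step_var * U n (fun x => f x * f x) t @[n --> \oo] -->
    step_var * renewal (fun x => f x * f x) t.
  by apply: cvgM; [exact: cvg_cst|exact: (cvg_renewal_sum gff)].
have key n := sum_var_bounds n t eta0 pfG.
have krn n : (1 + eta^-1) * (2 * Ex (fun w => Err n f G t w ^+ 2) +
    2 * Ex (fun w => G (t - S n w) * G (t - S n w))) <= rn n.
  by rewrite ler_wpM2l // lerD2r; have [_ h] := HC n f G t t0 pfG; lra.
split.
  apply: (lim_le cv (cvgD (cvgM (cvg_cst _) cU) crn)) => n.
  have [h _] := key n; apply: (le_trans h) => /=.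
  by rewrite lerD2l; exact: krn.
apply: (lim_le cU (cvgD (cvgM (cvg_cst _) cv) crn)) => n.
have [_ h] := key n; apply: (le_trans h) => /=.
by rewrite lerD2l; exact: krn.
Qed.

(** The contribution at time [t] of a litter born at the times [z], measured by
    [f]. *)
Definition offspring (f : R -> R) (z : nat -> R) (t : R) : \bar R :=
  (\sum_(i <oo) (f (t - z i))%:E)%E.

Definition later_sum n (f : R -> R) (t : R) w : R := \sum_(k < n) f (t - S k.+1 w).

Lemma later_sumE n f t w : later_sum n f t w = term_sum n.+1 f t w - f t.
Proof.
by rewrite /later_sum /term_sum big_ord_recl walk0 subr0 addrC addKr.
Qed.

Lemma later_sum_ge0 n f t w : growth f -> 0 <= later_sum n f t w.
Proof. by move=> gf; apply: sumr_ge0 => k _; exact: growth_ge0. Qed.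

Lemma later_sum_nd f t w : growth f ->
  {homo (fun n => later_sum n f t w) : n n' / (n <= n')%N >-> n <= n'}.
Proof.
move=> gf; apply/nondecreasing_seqP => n.
by rewrite /later_sum big_ord_recr lerDl growth_ge0.
Qed.

Lemma int2_later_sum n f t : growth f -> int2 P (later_sum n f t).
Proof.
move=> gf; have := int2B (int2_term_sum n.+1 t gf) (int2_cst P (f t)).
by congr int2; apply/funext => w; rewrite later_sumE.
Qed.

Lemma offspring_walk f t w :
  offspring f (fun i => S i.+1 w) t = limn (fun n => (later_sum n f t w)%:E).
Proof.
have -> : (fun n => (later_sum n f t w)%:E) =
    (fun n => \sum_(0 <= i < n) (f (t - S i.+1 w))%:E)%E => //.
by apply/funext => n; rewrite sumEFin big_mkord.
Qed.

Lemma offspring_walk_cvg f t w : growth f ->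
  (later_sum n f t w)%:E @[n --> \oo] --> offspring f (fun i => S i.+1 w) t.
Proof.
move=> gf; rewrite offspring_walk; apply: ereal_nondecreasing_is_cvgn.
by move=> n n' nn'; rewrite lee_fin; exact: (later_sum_nd t w gf nn').
Qed.

(** The expectation of the sum of [f (t - S_k)] over [k >= 1], that is over the
    children of an individual born at time [0]. *)
Definition descend (f : R -> R) (t : R) : R := renewal f t - f t.
Local Notation V := descend.

Lemma Ex_later_sum n f t : growth f -> Ex (later_sum n f t) = U n.+1 f t - f t.
Proof.
move=> gf; rewrite -Ex_term_sum // -[f t in RHS](Ex_cst P) -ExB.
- by apply: eq_Rintegral => w _; exact: later_sumE.
- exact/int2_int1/int2_term_sum.
- exact: int1_cst.
Qed.

Lemma cvg_Ex_later_sum f t : growth f -> Ex (later_sum n f t) @[n --> \oo] --> V f t.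
Proof.
move=> gf; under eq_fun do rewrite Ex_later_sum //.
apply: cvgB; last exact: cvg_cst.
have := cvg_shiftS (fun n => U n f t) (nbhs (renewal f t)) => ->.
exact: cvg_renewal_sum.
Qed.

Lemma cvg_EFin_seq (u : R ^nat) (l : R) :
  u n @[n --> \oo] --> l -> (u n)%:E @[n --> \oo] --> l%:E.
Proof. by move=> ul; apply: cvg_EFin => //; apply: nearW. Qed.

Lemma integral_offspring f t : growth f ->
  (\int[P]_w offspring f (fun i => S i.+1 w) t = (V f t)%:E)%E.
Proof.
move=> gf; under eq_integral => w _ do rewrite offspring_walk.
rewrite (monotone_convergence P measurableT) /=.
- apply/cvg_lim => //; under eq_fun => n.
    rewrite -EFin_Ex; last exact/int2_int1/int2_later_sum.
    over.
  by apply: cvg_EFin_seq; exact: cvg_Ex_later_sum.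
- by move=> n; apply/measurable_EFinP; case: (int2_later_sum n t gf).
- by move=> n w _; rewrite lee_fin later_sum_ge0.
- by move=> w _ n n' nn'; rewrite lee_fin; exact: (later_sum_nd t w gf nn').
Qed.

(** Dropping the deterministic term [k = 0] does not change the variance. *)
Lemma integral_offspring_sqr f G t : primitive f G ->
  (\int[P]_w (offspring f (fun i => S i.+1 w) t * offspring f (fun i => S i.+1 w) t)
   = ((V f t) ^+ 2 + renewal_var f t)%:E)%E.
Proof.
move=> pfG; have [gf gG _] := pfG.
have sqE w : (offspring f (fun i => S i.+1 w) t * offspring f (fun i => S i.+1 w) t =
    limn (fun n => ((later_sum n f t w) ^+ 2)%:E))%E.
  apply/esym/cvg_lim => //; under eq_fun => n do rewrite expr2 EFinM.
  apply: cvgeM; try exact: offspring_walk_cvg.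
  by case: (offspring _ _ _) => [r| |] //=; rewrite /mule_def /=.
under eq_integral => w _ do rewrite sqE.
rewrite (monotone_convergence P measurableT) /=.
- apply/cvg_lim => //; under eq_fun => n.
    rewrite -EFin_Ex; last by case: (int2_later_sum n t gf).
    over.
  apply: cvg_EFin_seq.
  have EE n : Ex (fun w => later_sum n f t w ^+ 2) =
      Ex (fun w => term_sum n.+1 f t w ^+ 2) - 2 * f t * U n.+1 f t + (f t) ^+ 2.
    have iT := int2_term_sum n.+1 t gf; have i1T := int2_int1 iT.
    have -> : (fun w => later_sum n f t w ^+ 2) =
       (fun w => (term_sum n.+1 f t w ^+ 2 - 2 * f t * term_sum n.+1 f t w) + (f t) ^+ 2).
      by apply/funext => w; rewrite later_sumE; ring.
    case: iT => _ iT.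
    rewrite ExD; [|by apply: int1B => //; exact: int1Z|exact: int1_cst].
    by rewrite ExB //; [rewrite ExZ // Ex_term_sum // Ex_cst|exact: int1Z].
  under eq_fun do rewrite EE.
  have -> : (V f t) ^+ 2 + renewal_var f t =
      second_moment f t - 2 * f t * renewal f t + (f t) ^+ 2.
    by rewrite /V /renewal_var; ring.
  apply: cvgD; last exact: cvg_cst.
  apply: cvgB.
    have := cvg_shiftS (fun n => Ex (fun w => term_sum n f t w ^+ 2))
      (nbhs (second_moment f t)) => ->.
    exact: cvg_second_moment pfG.
  apply: cvgM; first exact: cvg_cst.
  have := cvg_shiftS (fun n => U n f t) (nbhs (renewal f t)) => ->.
  exact: cvg_renewal_sum.
- by move=> n; apply/measurable_EFinP; case: (int2_later_sum n t gf) => _ /int1_measurable.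
- by move=> n w _; rewrite lee_fin sqr_ge0.
- move=> w _ n n' nn'; rewrite lee_fin lerXn2r ?nnegrE ?later_sum_ge0 //.
  exact: (later_sum_nd t w gf nn').
Qed.

Lemma growth_descend f : growth f -> growth (V f).
Proof.
move=> gf; split=> [x y xy|x x0].
  apply: (lim_le (@cvg_Ex_later_sum f x gf) (@cvg_Ex_later_sum f y gf)) => n.
  apply: Ex_le; [exact/int2_int1/int2_later_sum|exact/int2_int1/int2_later_sum|].
  by move=> w; apply: ler_sum => k _; case: gf => ndf _; apply: ndf; rewrite lerD2r.
apply/eqP; rewrite eq_le; apply/andP; split.
  apply: (lim_le (@cvg_Ex_later_sum f x gf) (cvg_cst 0)) => n.
  rewrite Ex_later_sum // renewal_sum_neg // sub0r oppr_le0.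
  exact: growth_ge0.
apply: (lim_le (cvg_cst 0) (@cvg_Ex_later_sum f x gf)) => n.
by apply: Ex_ge0 => w; exact: later_sum_ge0.
Qed.

(** [V] averages over translations, so it commutes with integration. *)
Lemma primitive_descend f G : primitive f G -> primitive (V f) (V G).
Proof.
move=> [gf gG fG]; split; [exact: growth_descend|exact: growth_descend|].
move=> x h h0.
have cf y := @cvg_Ex_later_sum f y gf; have cG y := @cvg_Ex_later_sum G y gG.
have i1f y n : int1 P (later_sum n f y) by exact/int2_int1/int2_later_sum.
have i1G y n : int1 P (later_sum n G y) by exact/int2_int1/int2_later_sum.
have key n w : h * later_sum n f (x - h) w <=
    later_sum n G x w - later_sum n G (x - h) w <= h * later_sum n f x w.
  rewrite /later_sum !mulr_sumr -sumrB.
  have sw k : x - h - S k.+1 w = x - S k.+1 w - h by rewrite addrAC.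
  apply/andP; split; apply: ler_sum => k _; rewrite sw;
    by case/andP: (fG (x - S k.+1 w) h h0).
apply/andP; split.
  apply: (lim_le (cvgM (cvg_cst h) (cf (x - h))) (cvgB (cG x) (cG (x - h)))) => n /=.
  rewrite -ExZ // -ExB //; apply: Ex_le => [||w].
  - exact: int1Z.
  - exact: int1B.
  - by case/andP: (key n w).
apply: (lim_le (cvgB (cG x) (cG (x - h))) (cvgM (cvg_cst h) (cf x))) => n /=.
rewrite -ExZ // -ExB //; apply: Ex_le => [||w].
- exact: int1B.
- exact: int1Z.
- by case/andP: (key n w).
Qed.

(** * Polynomial growth at infinity *)

Definition asym (f : R -> R) (p : nat) (a : R) : Prop :=
  (f t / t ^+ p) @[t --> +oo] --> a.

Lemma inv_cvg0 (C : R) : (C / t) @[t --> +oo] --> (0 : R).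
Proof.
apply/cvgrPdist_le => e e0; near=> t.
have t0 : 0 < t by near: t; exact: nbhs_pinfty_gt.
rewrite sub0r normrN normrM normfV (gtr0_norm t0) ler_pdivrMr // mulrC -ler_pdivrMr //.
Unshelve. all: by end_near. Qed.

Lemma asym_ppow p : asym (ppow p) p (p`!%:R)^-1.
Proof.
apply: cvg_near_cst; near=> t.
have t0 : 0 < t by near: t; exact: nbhs_pinfty_gt.
by rewrite /ppow ltW // mulrAC divff ?mul1r // gt_eqF // exprn_gt0.
Unshelve. all: by end_near. Qed.

Lemma asym_weaken f p a : asym f p a -> asym f p.+1 0.
Proof.
move=> fa; rewrite /asym -[X in _ --> X](mulr0 a).
have -> : (fun t => f t / t ^+ p.+1) = (fun t => (f t / t ^+ p) * (1 / t)).
  by apply/funext => t; rewrite exprSr invfM mulrA mul1r.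
by apply: cvgM => //; exact: inv_cvg0.
Qed.

Lemma asym_weakenn f p q a : (p < q)%N -> asym f p a -> asym f q 0.
Proof.
elim: q => // q IH; rewrite ltnS leq_eqVlt => /orP[/eqP <-|pq fa]; first exact: asym_weaken.
by apply: (@asym_weaken _ _ 0); exact: IH.
Qed.

Lemma asym_bound (u : R -> R) (l B : R) : u t @[t --> +oo] --> l -> l < B ->
  \forall t \near +oo, u t <= B.
Proof. by move=> ul lB; exact: (cvgr_le _ ul _ lB). Qed.

(** Divide [renewal_primitive] by [t ^+ p.+1]: as [f] is of order [t ^+ p], the
    error is at most a small multiple of [t ^+ p.+1]. *)
Lemma asym_renewal f G p a b : primitive f G -> asym f p a -> asym G p.+1 b ->
  asym (renewal f) p.+1 (b / m).
Proof.
move=> pfG fa Gb; have [gf gG _] := pfG; have m0 := mean_gt0.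
suff H : (m * (renewal f t / t ^+ p.+1) - G t / t ^+ p.+1) @[t --> +oo] --> (0 : R).
  rewrite /asym; have -> : (fun t => renewal f t / t ^+ p.+1) =
      (fun t => m^-1 * (m * (renewal f t / t ^+ p.+1) - G t / t ^+ p.+1 + G t / t ^+ p.+1)).
    by apply/funext => t; rewrite subrK mulKf // gt_eqF.
  rewrite mulrC -[X in _ * X]add0r; apply: cvgM; first exact: cvg_cst.
  exact: cvgD.
apply/cvgrPdist_le => e e0.
pose B := `|a| + 1; have B0 : 0 < B by rewrite ltr_wpDl.
(* [B] bounds [f t / t ^+ p]; the error [B * (e / (2 * B) + C / t)] is split into
   two halves. *)
have [|C C0 HC] := @renewal_primitive (e / (2 * B)).
  by rewrite divr_gt0 // mulr_gt0.
near=> t.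
have t0 : 0 < t by near: t; exact: nbhs_pinfty_gt.
have tp : 0 < t ^+ p by rewrite exprn_gt0.
have fB : f t / t ^+ p <= B.
  near: t; apply: (asym_bound fa); rewrite /B (le_lt_trans (ler_norm _)) //.
  by rewrite ltrDl.
have Ct : C / t <= e / (2 * B).
  near: t; apply: (asym_bound (inv_cvg0 C)).
  by rewrite divr_gt0 // mulr_gt0.
have /andP[h1 h2] := HC f G t (ltW t0) pfG.
have f0 : 0 <= f t / t ^+ p by rewrite divr_ge0 ?(growth_ge0 _ gf) // ltW.
rewrite sub0r normrN mulrA -mulrBl ger0_norm; last first.
  by rewrite mulr_ge0 ?subr_ge0 // invr_ge0 exprn_ge0 // ltW.
have step1 : (m * renewal f t - G t) / t ^+ p.+1 <=
    f t * (e / (2 * B) * t + C) / t ^+ p.+1.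
  by rewrite ler_wpM2r ?invr_ge0 ?exprn_ge0 ?(ltW t0) // lerBlDl.
apply: (le_trans step1).
have -> : f t * (e / (2 * B) * t + C) / t ^+ p.+1 =
    (f t / t ^+ p) * (e / (2 * B) + C / t).
  rewrite exprS; field; rewrite ?gt_eqF //.
apply: (@le_trans _ _ (B * (e / (2 * B) + e / (2 * B)))).
  by rewrite ler_pM // ?lerD2l // addr_ge0 // divr_ge0 // ltW // mulr_gt0.
suff -> : B * (e / (2 * B) + e / (2 * B)) = e by [].
by field; rewrite gt_eqF.
Unshelve. all: by end_near. Qed.

Lemma asym_descend f G p a b : primitive f G -> asym f p a -> asym G p.+1 b ->
  asym (V f) p.+1 (b / m).
Proof.
move=> pfG fa Gb; rewrite /asym -[X in _ --> X]subr0.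
have -> : (fun t => V f t / t ^+ p.+1) =
    (fun t => renewal f t / t ^+ p.+1 - f t / t ^+ p.+1).
  by apply/funext => t; rewrite /V mulrBl.
by apply: cvgB; [exact: asym_renewal fa Gb|exact: asym_weaken fa].
Qed.

Definition iter_descend i f := iter i V f.

Lemma primitive_iter i p : primitive (iter_descend i (ppow p)) (iter_descend i (ppow p.+1)).
Proof.
elim: i => [|i IH]; first exact: primitive_ppow.
exact: primitive_descend.
Qed.

(** Induction on [i] for all [p] at once, because the step for [ppow p] needs the
    growth of its primitive, which is the iterate on [ppow p.+1]. *)
Lemma asym_iter i p : asym (iter_descend i (ppow p)) (p + i) (((p + i)`!)%:R * m ^+ i)^-1.
Proof.
elim: i p => [|i IH] p; first by rewrite addn0 expr0 mulr1; exact: asym_ppow.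
have := asym_descend (primitive_iter i p) (@IH p) (@IH p.+1).
by rewrite -invfM -mulrA -exprSr addSn addnS.
Qed.

(** [f * f] is compared with a multiple of [ppow i.*2] up to a relative error and
    up to a multiple of the indicator. The latter contributes a term of order [t],
    which is negligible only if [0 < i]; hence the separate case [i = 0], where [f]
    is the indicator itself. *)
Lemma asym_renewal_sqr f G i a : primitive f G -> asym f i a ->
  (i = 0%N -> f = step) ->
  asym (renewal (fun x => f x * f x)) i.*2.+1 (a ^+ 2 / (i.*2.+1%:R * m)).
Proof.
move=> pfG fa f0; have [gf gG _] := pfG; have m0 := mean_gt0.
have gff := growthM gf gf.
have asymU p : asym (renewal (ppow p)) p.+1 ((p.+1`!)%:R^-1 / m).
  exact: (asym_renewal (primitive_ppow p) (@asym_ppow p) (@asym_ppow p.+1)).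
have [i0|i0] := posnP i.
  subst i; rewrite (f0 erefl) in fa *.
  have a1 : a = 1.
    have := @asym_ppow 0; rewrite fact0 invr1 => h.
    exact: cvg_unique fa h.
  have -> : (fun x : R => step x * step x) = step.
    apply/funext => x; rewrite /ppow expr0 fact0 divr1.
    by case: ifP; rewrite ?mulr0 ?mulr1.
  have := @asymU 0%N; rewrite a1 expr1n factS fact0 muln1 invr1.
  by rewrite !mul1r.
pose rho t := (i.*2`!)%:R * (renewal (ppow i.*2) t / t ^+ i.*2.+1).
pose kap t := renewal step t / t ^+ i.*2.+1.
pose L := (i.*2.+1%:R * m)^-1.
have rhoL : rho t @[t --> +oo] --> L.
  have -> : L = (i.*2`!)%:R * ((i.*2.+1`!)%:R^-1 / m).
    have fE (F n : R) : F != 0 -> n != 0 -> (n * m)^-1 = F * ((n * F)^-1 / m).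
      by move=> F0 n0; field; rewrite F0 n0 gt_eqF.
    by rewrite /L factS natrM -fE // pnatr_eq0 // -lt0n fact_gt0.
  by apply: cvgM; [exact: cvg_cst|exact: asymU].
have kap0 : kap t @[t --> +oo] --> (0 : R).
  by apply: (asym_weakenn _ (@asymU 0%N)); rewrite ltnS double_gt0.
apply/cvgrPdist_le => e e0.
pose B := `|L| + 1; have B0 : 0 < B by rewrite ltr_wpDl.
pose de := e / (4 * B); have de0 : 0 < de by rewrite divr_gt0 // mulr_gt0.
have sq : (f t / t ^+ i) ^+ 2 @[t --> +oo] --> a ^+ 2.
  by rewrite expr2; under eq_fun do rewrite expr2; exact: cvgM.
have [T T0 HT] : exists2 T, 0 < T & forall x, T <= x ->
    `|a ^+ 2 - (f x / x ^+ i) ^+ 2| <= de.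
  move/cvgrPdist_le : sq => /(_ _ de0) [T [_ HT]].
  exists (Num.max 1 (T + 1)); first by rewrite lt_max ltr01.
  move=> x; rewrite ge_max => /andP[_ Tx]; apply: HT.
  by rewrite (lt_le_trans _ Tx) // ltrDl.
have HT2 x : T <= x -> `|a ^+ 2 * x ^+ i.*2 - f x * f x| <= de * x ^+ i.*2.
  move=> Tx; have x0 := lt_le_trans T0 Tx.
  have xi0 : 0 < x ^+ i by rewrite exprn_gt0.
  have xE : x ^+ i.*2 = (x ^+ i) ^+ 2 by rewrite -mul2n mulnC exprM.
  have -> : a ^+ 2 * x ^+ i.*2 - f x * f x =
     (a ^+ 2 - (f x / x ^+ i) ^+ 2) * x ^+ i.*2.
    by rewrite xE; field; rewrite gt_eqF.
  have xp0 : 0 <= x ^+ i.*2 by rewrite exprn_ge0 // ltW.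
  rewrite normrM (ger0_norm xp0); apply: ler_wpM2r => //; exact: HT.
(* On [[0, T]] both functions are bounded, by the two summands of [C]. *)
pose C := f T * f T + a ^+ 2 * T ^+ i.*2.
have aT0 : 0 <= a ^+ 2 * T ^+ i.*2.
  by apply: mulr_ge0; [exact: sqr_ge0|apply: exprn_ge0; exact: ltW].
have fT0 : 0 <= f T * f T by exact: (growth_ge0 _ gff).
have C0 : 0 <= C by exact: addr_ge0.
pose F := (i.*2`!)%:R : R.
have F0 : F != 0 by rewrite pnatr_eq0 -lt0n fact_gt0.
have gE x : 0 <= x -> F * ppow i.*2 x = x ^+ i.*2.
  by move=> x0; rewrite /ppow x0 mulrCA divff // mulr1.
have up x : 1 * (f x * f x) <= ((a ^+ 2 + de) * F) * ppow i.*2 x + C * step x.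
  have [x0|x0] := ltP x 0.
    have [_ z1] := gf; have [_ z2] := growth_ppow (R:=R) i.*2.
    have [_ z3] := growth_ppow (R:=R) 0.
    by rewrite z1 // z2 // z3 // !mulr0 addr0.
  rewrite mul1r -mulrA gE // ppow0 // mulr1.
  have xp : 0 <= x ^+ i.*2 by rewrite exprn_ge0.
  have [Tx|xT] := leP T x.
    have := HT2 x Tx; rewrite ler_norml => /andP[+ _]; rewrite /C; nra.
  have : f x * f x <= f T * f T.
    by case: gff => nd _; apply: nd; exact: ltW.
  have : 0 <= (a ^+ 2 + de) * x ^+ i.*2.
    by rewrite mulr_ge0 // addr_ge0 ?sqr_ge0 // ltW.
  rewrite /C; lra.
have lo x : ((a ^+ 2 - de) * F) * ppow i.*2 x <= 1 * (f x * f x) + C * step x.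
  have [x0|x0] := ltP x 0.
    have [_ z1] := gf; have [_ z2] := growth_ppow (R:=R) i.*2.
    have [_ z3] := growth_ppow (R:=R) 0.
    by rewrite z1 // z2 // z3 // !mulr0 addr0.
  rewrite mul1r -mulrA gE // ppow0 // mulr1.
  have xp : 0 <= x ^+ i.*2 by rewrite exprn_ge0.
  have [Tx|xT] := leP T x.
    have := HT2 x Tx; rewrite ler_norml => /andP[_]; rewrite /C; nra.
  have : 0 <= f x * f x by exact: (growth_ge0 _ gff).
  have : a ^+ 2 * x ^+ i.*2 <= a ^+ 2 * T ^+ i.*2.
    by rewrite ler_wpM2l ?sqr_ge0 // lerXn2r ?nnegrE ?(ltW T0) // ltW.
  have : 0 <= de * x ^+ i.*2 by rewrite mulr_ge0 // ltW.
  rewrite /C; lra.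
have cv : a ^+ 2 * rho t @[t --> +oo] --> a ^+ 2 * L.
  by apply: cvgM => //; exact: cvg_cst.
near=> t.
have t0 : 0 < t by near: t; exact: nbhs_pinfty_gt.
have tp : 0 < t ^+ i.*2.+1 by rewrite exprn_gt0.
have rB : rho t <= B.
  near: t; apply: (asym_bound rhoL); rewrite /B (le_lt_trans (ler_norm _)) //.
  by rewrite ltrDl.
have r0 : 0 <= rho t.
  rewrite /rho mulr_ge0 // divr_ge0 ?(ltW tp) // renewal_ge0 //.
  exact: growth_ppow.
have k0 : C * kap t <= e / 4.
  near: t; apply: (@asym_bound (fun t => C * kap t) (C * 0)).
    by apply: cvgM => //; exact: cvg_cst.
  by rewrite mulr0 divr_gt0.
have rL : `|a ^+ 2 * L - a ^+ 2 * rho t| <= e / 4.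
  near: t; move/cvgrPdist_le : cv; apply.
  by rewrite divr_gt0.
have u1 := @renewal_le_comb ((a ^+ 2 + de) * F) 1 C _ _ _ t
  gff (growth_ppow i.*2) (growth_ppow 0) up.
have l1 := @renewal_le_comb 1 ((a ^+ 2 - de) * F) C _ _ _ t
  (growth_ppow i.*2) gff (growth_ppow 0) lo.
set y := _ / t ^+ _.
have u2 : y <= (a ^+ 2 + de) * rho t + C * kap t.
  rewrite /y /rho /kap -/F !mulrA -mulrDl ler_pdivrMr // divfK ?gt_eqF //.
  by move: u1; rewrite mul1r.
have l2 : (a ^+ 2 - de) * rho t <= y + C * kap t.
  rewrite /y /rho /kap -/F !mulrA -mulrDl ler_pdivlMr // divfK ?gt_eqF //.
  by move: l1; rewrite mul1r.
have h : de * rho t <= e / 4.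
  apply: (le_trans (ler_wpM2l (ltW de0) rB)).
  suff -> : de * B = e / 4 by [].
  by rewrite /de; field; rewrite gt_eqF.
move: rL u2 l2 h k0; rewrite -/L !ler_norml => /andP[].
move: (rho t) (a ^+ 2 * L) (C * kap t) y => r aL c y q1 q2 u2 l2 h k0.
by clear - q1 q2 u2 l2 h k0 e0; apply/andP; split; lra.
Unshelve. all: by end_near. Qed.

(** If [y] and [z] dominate each other up to the factor [1 + eta] and the error
    [r], they are close; [B] bounds [z]. *)
Lemma two_sided_close (e eta B r l y z : R) : 0 < e -> 0 < eta -> eta <= 1 ->
  eta * B <= e / 8 -> 0 <= r -> r <= e / 8 -> z <= B -> `|l - z| <= e / 8 ->
  y <= (1 + eta) * z + r -> z <= (1 + eta) * y + r -> `|l - y| <= e.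
Proof.
clear; move=> e0 eta0 eta1 etaB r0 rle zB; rewrite !ler_norml => /andP[b1 b2] k1 k2.
have ez : eta * z <= e / 8 by rewrite (le_trans _ etaB) // ler_wpM2l // ltW.
have y1 : y <= z + e / 4 by lra.
have ey : eta * y <= eta * (z + e / 4) by rewrite ler_wpM2l // ltW.
have ee : eta * (e / 4) <= e / 4 by rewrite ler_piMl // divr_ge0 // ltW.
have z1 : z <= y + (e / 8 + e / 4) + e / 8 by lra.
by apply/andP; split; lra.
Qed.

(** [renewal_var_bounds] with [eta] and then the precision of the Riemann error
    chosen small in terms of [e]. *)
Lemma asym_renewal_var f G i a b : primitive f G -> asym f i a ->
  asym (renewal (fun x => f x * f x)) i.*2.+1 b ->
  asym (renewal_var f) i.*2.+1 (step_var * b / m ^+ 2).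
Proof.
move=> pfG fa fb; have [gf gG _] := pfG; have m0 := mean_gt0.
have m2 : 0 < m ^+ 2 by rewrite exprn_gt0.
have gff := growthM gf gf.
pose z t := step_var * (renewal (fun x => f x * f x) t / t ^+ i.*2.+1).
pose y t := m ^+ 2 * (renewal_var f t / t ^+ i.*2.+1).
have cz : z t @[t --> +oo] --> step_var * b by apply: cvgM => //; exact: cvg_cst.
suff cy : y t @[t --> +oo] --> step_var * b.
  rewrite /asym; have -> : (fun t => renewal_var f t / t ^+ i.*2.+1) =
      (fun t => (m ^+ 2)^-1 * y t).
    by apply/funext => t; rewrite /y mulKf // gt_eqF.
  by rewrite mulrC; apply: cvgM => //; exact: cvg_cst.
have sq : (f t / t ^+ i) ^+ 2 @[t --> +oo] --> a ^+ 2.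
  by rewrite expr2; under eq_fun do rewrite expr2; exact: cvgM.
apply/cvgrPdist_le => e e0.
pose B := `|step_var * b| + 1; have B1 : 1 <= B by rewrite /B lerDr.
have B0 : 0 < B by rewrite (lt_le_trans ltr01).
pose Phi := a ^+ 2 + 1; have Phi0 : 0 < Phi by rewrite ltr_wpDl ?sqr_ge0.
(* Small enough for [eta <= 1] and [eta * B <= e / 8]. *)
pose eta := e / (8 * B + e).
have den0 : 0 < 8 * B + e by rewrite addr_gt0 // mulr_gt0.
have eta0 : 0 < eta by rewrite divr_gt0.
have eta1 : eta <= 1 by rewrite ler_pdivrMr // mul1r lerDr mulr_ge0 // ltW.
have etaB : eta * B <= e / 8.
  by rewrite /eta mulrAC ler_pdivrMr // mulrC; nra.
pose K := 1 + eta^-1; have K0 : 0 < K by rewrite addr_gt0 // invr_gt0.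
(* Once [C / t <= e1], the error is at most [4 * (K * Phi * e1) = e / 8]. *)
pose e1 := e / (32 * (K * Phi)).
have KP0 : 0 < K * Phi by rewrite mulr_gt0.
have e10 : 0 < e1 by rewrite divr_gt0 // mulr_gt0.
have Ke1 : K * Phi * e1 = e / 32.
  rewrite /e1; move: KP0; move: (K * Phi) => KP KP0.
  by field; rewrite gt_eqF.
have [C C0 HC] := renewal_var_bounds e10.
have cz2 : \forall t \near +oo, `|step_var * b - z t| <= e / 8.
  by move/cvgrPdist_le : cz; apply; rewrite divr_gt0.
near=> t.
have t0 : 0 < t by near: t; exact: nbhs_pinfty_gt.
have tp : 0 < t ^+ i.*2.+1 by rewrite exprn_gt0.
have zB : z t <= B.
  near: t; apply: (asym_bound cz); rewrite /B (le_lt_trans (ler_norm _)) //.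
  by rewrite ltrDl.
have fP : (f t / t ^+ i) ^+ 2 <= Phi.
  by near: t; apply: (asym_bound sq); rewrite ltrDl.
have Ct : C / t <= e1 by near: t; exact: (asym_bound (inv_cvg0 C)).
have zb : `|step_var * b - z t| <= e / 8 by near: t.
have [h1 h2] := HC eta f G t eta0 (ltW t0) pfG.
rewrite -/K in h1 h2; set r := K * _ in h1 h2.
have rE : r / t ^+ i.*2.+1 = K * (2 * ((f t / t ^+ i) ^+ 2 * (e1 + C / t))).
  have tE : t ^+ i.*2.+1 = (t ^+ i) ^+ 2 * t by rewrite exprSr -mul2n mulnC exprM.
  rewrite /r tE; have := gt_eqF t0; have : t ^+ i != 0 by rewrite gt_eqF // exprn_gt0.
  move: (t ^+ i) => u u0 t0'.
  by field; rewrite u0 t0'.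
have C1 : 0 <= e1 + C / t.
  by apply: addr_ge0; [exact: ltW|apply: divr_ge0 => //; exact: ltW].
have rle : r / t ^+ i.*2.+1 <= e / 8.
  rewrite rE; apply: (@le_trans _ _ (K * (2 * (Phi * (e1 + e1))))).
    rewrite ler_pM2l // ler_pM2l //.
    by apply: ler_pM => //; [exact: sqr_ge0|rewrite lerD2l].
  have -> : K * (2 * (Phi * (e1 + e1))) = 4 * (K * Phi * e1) by ring.
  by rewrite Ke1; suff -> : 4 * (e / 32) = e / 8 by []; field.
have r0 : 0 <= r / t ^+ i.*2.+1.
  rewrite rE; apply: mulr_ge0; first exact: ltW.
  by apply: mulr_ge0 => //; apply: mulr_ge0 => //; exact: sqr_ge0.
have z0 : 0 <= z t.
  by rewrite mulr_ge0 ?var_ge0 // divr_ge0 ?(ltW tp) // (renewal_ge0 _ gff).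
have iT : 0 <= (t ^+ i.*2.+1)^-1 by rewrite invr_ge0 ltW.
have k1 : y t <= (1 + eta) * z t + r / t ^+ i.*2.+1.
  by have := ler_wpM2r iT h1; rewrite mulrDl /y /z; congr (_ <= _ + _); ring.
have k2 : z t <= (1 + eta) * y t + r / t ^+ i.*2.+1.
  by have := ler_wpM2r iT h2; rewrite mulrDl /y /z; congr (_ <= _ + _); ring.
exact: two_sided_close e0 eta0 eta1 etaB r0 rle zB zb k1 k2.
Unshelve. all: by end_near. Qed.

Lemma renewal_var_le f G : primitive f G -> exists2 C, 0 <= C &
  forall t, 0 <= t -> renewal_var f t <= C * (f t * f t * (1 + t)).
Proof.
move=> pfG; have [gf gG _] := pfG; have m0 := mean_gt0.
have gff := growthM gf gf.
have m2 : 0 < m ^+ 2 by rewrite exprn_gt0.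
have [C1 C10 H1] := renewal_var_bounds ltr01.
have [C2 C20 H2] := renewal_step_le.
exists ((2 * step_var * C2 + 4 * (1 + C1)) / m ^+ 2).
  by rewrite divr_ge0 ?(ltW m2) // addr_ge0 ?mulr_ge0 ?var_ge0 ?addr_ge0.
move=> t t0; have [h _] := H1 1 f G t ltr01 t0 pfG.
have u := @renewal_le (fun x => f x * f x) t gff.
have ff0 : 0 <= f t * f t := growth_ge0 t gff.
have u2 := le_trans u (ler_wpM2l ff0 (H2 t t0)).
have u3 := ler_wpM2l var_ge0 u2.
rewrite mulrAC ler_pdivlMr // mulrC; apply: (le_trans h).
rewrite invr1; have : f t ^+ 2 * (1 * t + C1) <= f t * f t * ((1 + C1) * (1 + t)).
  by rewrite expr2 ler_wpM2l //; nra.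
move: u3; move: (f t * f t) (renewal _ _) => F U1 u3 hF.
have -> : (2 * step_var * C2 + 4 * (1 + C1)) * (F * (1 + t)) =
  2 * (step_var * (F * (C2 * (1 + t)))) + 4 * (F * ((1 + C1) * (1 + t))) by ring.
lra.
Qed.

Lemma descend_le : exists2 C, 0 <= C &
  forall f t, growth f -> 0 <= t -> V f t <= C * (f t * (1 + t)).
Proof.
have [C C0 H] := renewal_step_le; exists C => // f t gf t0.
have f0 := growth_ge0 t gf.
apply: (@le_trans _ _ (renewal f t)); first by rewrite /V gerBl.
by rewrite (le_trans (renewal_le t gf)) // mulrCA ler_wpM2l // H.
Qed.

Lemma renewal_var_ge0 f G t : primitive f G -> 0 <= renewal_var f t.
Proof.
move=> pfG; have [gf _ _] := pfG.
apply: (lim_le (cvg_cst 0) (@cvg_sum_var f G t pfG)) => n.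
by rewrite /sum_var subr_ge0 -Ex_term_sum // Ex_sqr_ge //; exact: int2_term_sum.
Qed.

Lemma renewal_var_neg f G t : primitive f G -> t < 0 -> renewal_var f t = 0.
Proof.
move=> pfG t0; have [gf _ _] := pfG; apply/eqP; rewrite eq_le.
rewrite (renewal_var_ge0 _ pfG) andbT.
apply: (lim_le (@cvg_sum_var f G t pfG) (cvg_cst 0)) => n.
rewrite /sum_var renewal_sum_neg // expr0n subr0 -[leRHS](Ex_cst P).
have -> // : (fun w => term_sum n f t w ^+ 2) = (fun=> 0).
by apply/funext => w; rewrite term_sum_neg // expr0n.
Qed.

(** A crude order of growth, enough for the terms that disappear in the limit. *)
Definition poly_bounded (f : R -> R) p :=
  exists2 C, 0 <= C & forall t, 0 <= t -> f t <= C * (1 + t) ^+ p.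

Lemma poly_bounded_descend f p : growth f ->
  poly_bounded f p -> poly_bounded (V f) p.+1.
Proof.
move=> gf [C C0 fC]; have [D D0 VD] := descend_le.
exists (D * C); first exact: mulr_ge0.
move=> t t0; apply: (le_trans (VD f t gf t0)).
rewrite -mulrA ler_wpM2l // exprSr mulrA ler_wpM2r ?addr_ge0 //.
exact: fC.
Qed.

Lemma poly_bounded_step : poly_bounded step 0.
Proof. by exists 1 => // t t0; rewrite ppow0 // expr0 mulr1. Qed.

Lemma poly_bounded_asym f p q : growth f -> poly_bounded f p -> (p < q)%N ->
  asym f q 0.
Proof.
move=> gf [C C0 fC] pq.
apply: (squeeze_cvgr _ (cvg_cst 0) (inv_cvg0 (C * 2 ^+ p))).
near=> t.
have t1 : 1 <= t by near: t; exact: nbhs_pinfty_ge.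
have t0 : 0 < t by exact: lt_le_trans t1.
rewrite divr_ge0 ?(growth_ge0 _ gf) ?exprn_ge0 ?(ltW t0) //=.
have tq : 0 < t ^+ q by rewrite exprn_gt0.
rewrite ler_pdivrMr // (le_trans (fC t (ltW t0))) //.
rewrite -!mulrA ler_wpM2l //.
case: q pq tq => // q; rewrite ltnS => pq tq; rewrite exprS mulKf ?gt_eqF //.
(* [1 + t <= 2 * t] for [1 <= t]. *)
apply: (@le_trans _ _ ((2 * t) ^+ p)).
  by rewrite lerXn2r ?nnegrE ?addr_ge0 ?mulr_ge0 ?(ltW t0) //; lra.
rewrite exprMn; apply: ler_wpM2l; first exact: exprn_ge0.
by rewrite ler_weXn2l.
Unshelve. all: by end_near. Qed.

(** The variance of a litter is not known to be monotone in time; it is replaced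
    by a monotone majorant of the same order. *)
Lemma renewal_var_bound f G p : primitive f G -> poly_bounded f p ->
  exists b, [/\ growth b, forall x, 0 <= renewal_var f x <= b x &
                poly_bounded b p.*2.+1].
Proof.
move=> pfG [D D0 fD]; have [gf _ _] := pfG; have [C C0 vC] := renewal_var_le pfG.
have gff := growthM gf gf.
exists (fun x => C * (f x * f x * (step x + ppow 1 x))); split.
- apply: growthZ => //; apply: (growthM gff).
  by apply: growthD; exact: growth_ppow.
- move=> x; rewrite (renewal_var_ge0 _ pfG) /=; have [x0|x0] := ltP x 0.
    rewrite (renewal_var_neg pfG x0); case: gf => _ f0; by rewrite f0 // !mul0r mulr0.
  by rewrite ppow0 // ppow1 //; exact: vC.
- exists (C * (D * D)); first by rewrite !mulr_ge0.
  move=> t t0; rewrite ppow0 // ppow1 // -[leRHS]mulrA; apply: ler_wpM2l => //.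
  rewrite exprSr -mul2n mulnC exprM expr2 !mulrA ler_wpM2r ?addr_ge0 //.
  have f0 := growth_ge0 t gf.
  have -> : D * D * (1 + t) ^+ p * (1 + t) ^+ p = (D * (1 + t) ^+ p) * (D * (1 + t) ^+ p).
    by ring.
  by apply: ler_pM => //; exact: fD.
Qed.

End walk.

(** * Sums over the words of a given length *)

Section generation_sum.
Context {R : realType}.
Local Open Scope ereal_scope.
Implicit Types (a b : seq nat -> \bar R) (l : nat).

(** Words of length [l] index the [l]-th generation. *)
Definition gsum l a : \bar R := \esum_(u in [set u : seq nat | size u = l]) a u.

(** The terms of [gsum] listed along an enumeration of all words, which gives
    access to the results on series. *)
Definition coded l a (n : nat) : \bar R :=
  if pickle_inv n is Some u then (if size u == l then a u else 0) else 0.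

Lemma coded_ge0 l a n : (forall u, 0 <= a u) -> 0 <= coded l a n.
Proof. by move=> a0; rewrite /coded; case: pickle_inv => // u; case: ifP. Qed.

Lemma gsum_series l a : (forall u, 0 <= a u) ->
  gsum l a = \sum_(n <oo) coded l a n.
Proof.
move=> a0; rewrite nneseries_esumT; last by move=> n; exact: coded_ge0.
pose D := [set u : seq nat | size u = l].
transitivity (\esum_(n in pickle @` D) coded l a n).
  rewrite esum_image; last by move=> u v _ _; exact: (pcan_inj pickleK_inv).
  by apply: eq_esum => u uD; rewrite /coded pickleK_inv uD eqxx.
rewrite esum_mkcond; apply: eq_esum => n _; case: ifPn => // nD.
rewrite /coded; case E : (pickle_inv n) => [u|//]; case: eqP => // ul.
case/negP: nD; rewrite inE; exists u => //.
by have := pickle_invK (T := seq nat) n; rewrite /oapp E.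
Qed.

Lemma gsum_ge0 l a : (forall u, 0 <= a u) -> 0 <= gsum l a.
Proof. by move=> a0; apply: esum_ge0. Qed.

Lemma eq_gsum l a b : (forall u, size u = l -> a u = b u) -> gsum l a = gsum l b.
Proof. by move=> ab; apply: eq_esum => u /= ul; exact: ab. Qed.

Lemma le_gsum l a b : (forall u, size u = l -> a u <= b u) -> gsum l a <= gsum l b.
Proof. by move=> ab; apply: le_esum => u /= ul; exact: ab. Qed.

Lemma gsumD l a b : (forall u, 0 <= a u) -> (forall u, 0 <= b u) ->
  gsum l (fun u => a u + b u) = gsum l a + gsum l b.
Proof. by move=> a0 b0; apply: esumD. Qed.

(** The factor may be infinite; a series is an integral for the counting measure. *)
Lemma ge0_nneseriesZl (c : \bar R) (a : nat -> \bar R) : 0 <= c -> (forall n, 0 <= a n) ->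
  \sum_(n <oo) c * a n = c * \sum_(n <oo) a n.
Proof.
move=> c0 a0; rewrite -!ge0_integral_count // => [|n]; last exact: mule_ge0.
by rewrite ge0_integralZl.
Qed.

Lemma gsumZl l c a : 0 <= c -> (forall u, 0 <= a u) ->
  gsum l (fun u => c * a u) = c * gsum l a.
Proof.
move=> c0 a0; rewrite !gsum_series //; last by move=> u; exact: mule_ge0.
rewrite -ge0_nneseriesZl // => [|n]; last exact: coded_ge0.
apply: eq_eseriesr => n _; rewrite /coded; case: pickle_inv => [u|]; last by rewrite mule0.
by case: ifP; rewrite ?mule0.
Qed.

Lemma gsum_mul l a b : (forall u, 0 <= a u) -> (forall u, 0 <= b u) ->
  gsum l a * gsum l b = gsum l (fun u => gsum l (fun v => a u * b v)).
Proof.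
move=> a0 b0; rewrite muleC -gsumZl ?gsum_ge0 //.
by apply: eq_gsum => u _; rewrite muleC gsumZl.
Qed.

(** Extracts the diagonal of a double sum. *)
Lemma gsum_delta l u c : size u = l -> 0 <= c ->
  gsum l (fun v => if v == u then c else 0) = c.
Proof.
move=> ul c0; rewrite /gsum.
transitivity (\esum_(v in [set v : seq nat | size v = l] `&` [set u]) c).
  rewrite esum_mkcondr; apply: eq_esum => v _; congr (if _ then _ else _).
  by apply/eqP/idP => [->|]; rewrite ?inE //= => /set_mem.
have -> : [set v : seq nat | size v = l] `&` [set u] = [set u].
  by apply/seteqP; split => [v []|v /= ->] //.
by rewrite esum_set1.
Qed.

Lemma gsum0 a : 0 <= a [::] -> gsum 0 a = a [::].
Proof.
move=> a0; rewrite /gsum.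
have -> : [set u : seq nat | size u = 0%N] = [set [::]].
  by apply/seteqP; split => [u /= /size0nil //|u /= ->].
by rewrite esum_set1.
Qed.

Lemma gsum_rcons l a : (forall u, 0 <= a u) ->
  gsum l.+1 a = gsum l (fun u => \sum_(i <oo) a (rcons u i)).
Proof.
move=> a0; rewrite /gsum.
under [RHS]eq_esum => u _ do rewrite nneseries_esumT //.
rewrite esum_esum //.
rewrite (@reindex_esum _ _ _ ([set u : seq nat | size u = l] `*`` (fun=> [set: nat]))
  [set u : seq nat | size u = l.+1] (fun k => rcons k.1 k.2)) //.
split.
- by move=> [u i] [/= ul _]; rewrite size_rcons ul.
- by move=> [u i] [v k] _ _ /= /rcons_inj.
- move=> v /=; case/lastP: v => // v x; rewrite size_rcons => -[vl].
  by exists (v, x).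
Qed.

(** An infinite set contains finite sets of any cardinality. *)
Lemma counting_esum (T : choiceType) (D : set T) :
  counting D = \esum_(u in D) (1 : \bar R).
Proof.
rewrite /counting; case: asboolP => fD.
  rewrite -(set_mem_set D) esum_fset ?set_mem_set // fsbig_finite //=.
  by rewrite big_const_seq count_predT -Monoid.iteropE /= -[RHS]/(_ *+ _) -EFin_natmul.
apply/esym/eqP; rewrite -leye_eq leNgt; apply/negP => fin.
have sum0 : 0 <= \esum_(u in D) (1 : \bar R) by exact: esum_ge0.
have finE : \esum_(u in D) (1 : \bar R) \is a fin_num by rewrite ge0_fin_numE.
pose M := Num.bound (fine (\esum_(u in D) (1 : \bar R))).
have [X XD cX] := infinite_set_fset M fD.
have : \sum_(u <- X) (1 : \bar R) <= \esum_(u in D) (1 : \bar R).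
  apply: ereal_sup_ubound; exists [set` X]; first by split => //; exact: finite_fset.
  by rewrite fsbig_finite //= set_fsetK.
rewrite big_const_seq count_predT -Monoid.iteropE /= -[X in X <= _]/(_ *+ _) -EFin_natmul.
rewrite -(fineK finE) lee_fin leNgt => /negP; apply.
by rewrite (lt_le_trans (archi_boundP _)) ?fine_ge0 // ler_nat.
Qed.

End generation_sum.

Section generation_sum_integral.
Context {d : measure_display} {Omega : measurableType d} {R : realType}
  (P : probability Omega R).
Local Open Scope ereal_scope.

Lemma measurable_coded d2 (T2 : measurableType d2) l (a : T2 -> seq nat -> \bar R) n :
  (forall u, measurable_fun [set: T2] (fun w => a w u)) ->
  measurable_fun [set: T2] (fun w => coded l (a w) n).
Proof.
by move=> ma; rewrite /coded; case: pickle_inv => [u|] //; case: (size u == l).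
Qed.

Lemma measurable_gsum d2 (T2 : measurableType d2) l (a : T2 -> seq nat -> \bar R) :
  (forall w u, 0 <= a w u) ->
  (forall u, measurable_fun [set: T2] (fun w => a w u)) ->
  measurable_fun [set: T2] (fun w => gsum l (a w)).
Proof.
move=> a0 ma; under eq_fun do rewrite gsum_series //.
apply: ge0_emeasurable_sum => n *; last exact: measurable_coded.
exact: coded_ge0.
Qed.

Lemma integral_gsum l (a : Omega -> seq nat -> \bar R) :
  (forall w u, 0 <= a w u) ->
  (forall u, measurable_fun [set: Omega] (fun w => a w u)) ->
  \int[P]_w gsum l (a w) = gsum l (fun u => \int[P]_w a w u).
Proof.
move=> a0 ma; rewrite gsum_series; last by move=> u; exact: integral_ge0.
under eq_integral do rewrite gsum_series //.
rewrite integral_nneseries //; last 2 first.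
- by move=> n; exact: measurable_coded.
- by move=> n w _; exact: coded_ge0.
apply: eq_eseriesr => n _; rewrite /coded; case: pickle_inv => [u|]; last exact: integral0.
by case: ifP => // _; exact: integral0.
Qed.

End generation_sum_integral.

(** * The branching recursion *)

Section branching.
Context {d : measure_display} {Omega : measurableType d} {R : realType}
  (P : probability Omega R) (T : seq nat -> Omega -> real_sequences R).
Local Notation others u := (g_sigma_algebraType (other_cylinders T u)).
Local Open Scope ereal_scope.

Hypothesis mT : forall u, measurable_fun [set: Omega] (T u).
Hypothesis indT : mutually_independent P T.
Variables (V q : (R -> R) -> R -> R).
Hypothesis growthV : forall f, growth f -> growth (V f).
Hypothesis integral_offspringT : forall u f t, growth f ->
  \int[P]_w offspring f (T u w) t = (V f t)%:E.
Hypothesis integral_offspringT_sqr : forall u f G t, primitive f G ->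
  \int[P]_w (offspring f (T u w) t * offspring f (T u w) t) =
    ((V f t) ^+ 2 + q f t)%:E.

Lemma measurable_coordinate i :
  measurable_fun [set: real_sequences R] (fun z : real_sequences R => z i).
Proof.
move=> _ B mB; rewrite setTI; apply: sub_sigma_algebra.
by exists i, B.
Qed.

Lemma offspring_ge0 (f : R -> R) z t : growth f -> 0 <= offspring f z t.
Proof. by move=> gf; apply: nneseries_ge0 => n _ _; rewrite lee_fin growth_ge0. Qed.

Lemma measurable_offspring (f : R -> R) : growth f ->
  measurable_fun setT (fun p : real_sequences R * R => offspring f p.1 p.2).
Proof.
move=> gf; apply: ge0_emeasurable_sum => i *; first by rewrite lee_fin growth_ge0.
apply/measurable_EFinP; apply: (measurableT_comp (growth_measurable gf)).
apply: measurable_funB; first exact: measurable_snd.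
exact: (measurableT_comp (measurable_coordinate i) measurable_fst).
Qed.

Lemma measurable_offspring_comp d2 (T2 : measurableType d2) (f : R -> R)
    (z : T2 -> real_sequences R) (x : T2 -> R) : growth f ->
  measurable_fun [set: T2] z -> measurable_fun [set: T2] x ->
  measurable_fun [set: T2] (fun w => offspring f (z w) (x w)).
Proof.
move=> gf mz mx.
exact: (measurableT_comp (measurable_offspring gf) (measurable_fun_pair mz mx)).
Qed.

Lemma birth_time_rcons (u : seq nat) (i : nat) w : birth_time T (rcons u i) w = (birth_time T u w + T u w i)%R.
Proof.
rewrite /birth_time size_rcons big_ord_recr /= nth_rcons ltnn eqxx.
rewrite -cats1 take_size_cat //; congr (_ + _)%R; apply: eq_bigr => k _.
by rewrite nth_cat ltn_ord takel_cat // ltnW.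
Qed.

(** The birth time of [u] only involves the litters of its proper ancestors, whose
    words are shorter than [u]. *)
Lemma measurable_birth_time_others (u v : seq nat) : (size u <= size v)%N ->
  measurable_fun [set: others v] (birth_time T u : others v -> R).
Proof.
move=> uv; apply: (@measurable_sum _ (others v)) => k.
apply: (measurableT_comp (measurable_coordinate _)); apply: measurable_others.
apply/eqP => E; have := congr1 size E; rewrite size_takel ?(ltnW (ltn_ord k)) // => ks.
by have := leq_trans (ltn_ord k) uv; rewrite ks ltnn.
Qed.

Lemma measurable_birth_time u : measurable_fun [set: Omega] (birth_time T u).
Proof.
exact: (measurable_from_others mT (measurable_birth_time_others (leqnn (size u)))).
Qed.

(** The second moment is monotone in time. *)
Lemma measurable_second_moment (u : seq nat) f G : primitive f G ->
  measurable_fun [set: R] (fun x => (V f x) ^+ 2 + q f x)%R.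
Proof.
move=> pfG; have [gf _ _] := pfG; have [ndf _] := gf.
have mO x : measurable_fun [set: Omega] (fun w => offspring f (T u w) x).
  by apply: measurable_offspring_comp => //; exact: measurable_cst.
apply: nondecreasing_measurable => // x y xy.
rewrite -lee_fin -!(integral_offspringT_sqr u _ pfG); apply: ge0_le_integral => //.
- by move=> w _; apply: mule_ge0; exact: offspring_ge0.
- exact: emeasurable_funM.
- exact: emeasurable_funM.
move=> w _; have le : offspring f (T u w) x <= offspring f (T u w) y.
  apply: lee_nneseries => [i _ _|i _]; first by rewrite lee_fin growth_ge0.
  by rewrite lee_fin; apply: ndf; rewrite lerD2r.
by apply: lee_pmul => //; exact: offspring_ge0.
Qed.

Section fixed_time.
Variable t : R.

Definition litter f u w : \bar R := offspring f (T u w) (t - birth_time T u w).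

Definition at_birth (f : R -> R) u w : \bar R := (f (t - birth_time T u w))%:E.

Definition generation l f w : \bar R := gsum l (fun u => at_birth f u w).

Lemma litter_ge0 f u w : growth f -> 0 <= litter f u w.
Proof. exact: offspring_ge0. Qed.

Lemma at_birth_ge0 f u w : growth f -> 0 <= at_birth f u w.
Proof. by move=> gf; rewrite lee_fin growth_ge0. Qed.

Lemma measurable_at_birth_others f u v : growth f -> (size u <= size v)%N ->
  measurable_fun [set: others v] (at_birth f u : others v -> \bar R).
Proof.
move=> gf uv; apply/measurable_EFinP; apply: (measurableT_comp (growth_measurable gf)).
by apply: measurable_funB => //; exact: measurable_birth_time_others.
Qed.

Lemma measurable_litter_others f u v : growth f -> (size u <= size v)%N -> u != v ->
  measurable_fun [set: others v] (litter f u : others v -> \bar R).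
Proof.
move=> gf uv neq; apply: (@measurable_offspring_comp _ (others v)) => //; first exact: measurable_others.
by apply: measurable_funB => //; exact: measurable_birth_time_others.
Qed.

Lemma measurable_at_birth f u : growth f -> measurable_fun [set: Omega] (at_birth f u).
Proof.
move=> gf.
exact: (measurable_from_others mT (measurable_at_birth_others gf (leqnn (size u)))).
Qed.

Lemma measurable_litter f u : growth f -> measurable_fun [set: Omega] (litter f u).
Proof.
move=> gf; apply: measurable_offspring_comp => //.
by apply: measurable_funB => //; exact: measurable_birth_time.
Qed.

Lemma generation_succ l f w : growth f ->
  generation l.+1 f w = gsum l (fun u => litter f u w).
Proof.
move=> gf; rewrite /generation gsum_rcons; last by move=> u; exact: at_birth_ge0.
apply: eq_gsum => u _; rewrite /litter /offspring; apply: eq_eseriesr => i _.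
by rewrite /at_birth birth_time_rcons opprD addrA.
Qed.

(** The litter of [u] is independent of its birth time and of [K], so it can be
    averaged separately. *)
Lemma integral_litterM f u (K : others u -> \bar R) : growth f ->
  measurable_fun [set: others u] K -> (forall w, 0 <= K w) ->
  \int[P]_w (litter f u w * K w) = \int[P]_w (at_birth (V f) u w * K w).
Proof.
move=> gf mK K0.
pose h (p : real_sequences R * others u) :=
  offspring f p.1 (t - birth_time T u p.2) * K p.2.
rewrite (_ : \int[P]_w (litter f u w * K w) = \int[P]_w h (T u w, w)) //.
rewrite (integral_independent mT indT).
- apply: eq_integral => w _; rewrite /h /=.
  rewrite ge0_integralZr ?integral_offspringT //.
  + by apply: measurable_offspring_comp => //; exact: measurable_cst.
  + by move=> v _; exact: offspring_ge0.
- apply: emeasurable_funM.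
    apply: measurable_offspring_comp => //.
    apply: measurable_funB => //.
    exact: (measurableT_comp (measurable_birth_time_others (leqnn (size u)))
      (@measurable_snd _ _ (real_sequences R) (others u))).
  exact: (measurableT_comp mK (@measurable_snd _ _ (real_sequences R) (others u))).
- by move=> p; apply: mule_ge0 => //; exact: offspring_ge0.
Qed.

Lemma integral_litter f u : growth f ->
  \int[P]_w litter f u w = \int[P]_w at_birth (V f) u w.
Proof.
move=> gf; have := @integral_litterM f u (fun=> 1) gf (measurable_cst _) (fun=> lee01).
by under eq_integral do rewrite mule1; under [X in _ = X -> _]eq_integral do rewrite mule1.
Qed.

Lemma integral_litter_sqr f G u : primitive f G ->
  \int[P]_w (litter f u w * litter f u w) =
  \int[P]_w ((V f (t - birth_time T u w)) ^+ 2 + q f (t - birth_time T u w))%:E.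
Proof.
move=> pfG; have [gf _ _] := pfG.
pose h (p : real_sequences R * others u) :=
  offspring f p.1 (t - birth_time T u p.2) * offspring f p.1 (t - birth_time T u p.2).
rewrite (_ : \int[P]_w (litter f u w * litter f u w) = \int[P]_w h (T u w, w)) //.
rewrite (integral_independent mT indT).
- apply: eq_integral => w _; rewrite /h /=.
  exact: integral_offspringT_sqr pfG.
- have mO : measurable_fun setT (fun p : real_sequences R * others u =>
    offspring f p.1 (t - birth_time T u p.2)).
    apply: measurable_offspring_comp => //.
    apply: measurable_funB => //.
    exact: (measurableT_comp (measurable_birth_time_others (leqnn (size u)))
      (@measurable_snd _ _ (real_sequences R) (others u))).
  exact: emeasurable_funM.
- by move=> p; apply: mule_ge0 => //; exact: offspring_ge0.
Qed.

(** Two individuals of the same generation: each litter is independent of the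
    other one and of both birth times, and the two averages are taken in turn. *)
Lemma integral_litter_cross f u v : growth f -> size u = size v -> u != v ->
  \int[P]_w (litter f u w * litter f v w) =
  \int[P]_w (at_birth (V f) u w * at_birth (V f) v w).
Proof.
move=> gf uv neq; have gV := growthV gf.
rewrite integral_litterM //; last 2 first.
- by apply: measurable_litter_others => //; rewrite ?uv // eq_sym.
- by move=> w; exact: litter_ge0.
under eq_integral do rewrite muleC.
rewrite integral_litterM //; last 2 first.
- by apply: measurable_at_birth_others => //; rewrite uv.
- by move=> w; exact: at_birth_ge0.
by under eq_integral do rewrite muleC.
Qed.

Lemma measurable_generation l f : growth f -> measurable_fun [set: Omega] (generation l f).
Proof.
move=> gf; apply: measurable_gsum => [w u|u]; first exact: at_birth_ge0.
exact: measurable_at_birth.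
Qed.

Lemma generation_ge0 l f w : growth f -> 0 <= generation l f w.
Proof. by move=> gf; apply: gsum_ge0 => u; exact: at_birth_ge0. Qed.

Lemma integral_generation_succ l f : growth f ->
  \int[P]_w generation l.+1 f w = \int[P]_w generation l (V f) w.
Proof.
move=> gf; have gV := growthV gf.
under eq_integral do rewrite generation_succ //.
rewrite integral_gsum => [|w u|u]; [|exact: litter_ge0|exact: measurable_litter].
rewrite [RHS]integral_gsum => [|w u|u]; [|exact: at_birth_ge0|exact: measurable_at_birth].
by apply: eq_gsum => u _; exact: integral_litter.
Qed.

Lemma generation0 f w : growth f -> generation 0 f w = (f t)%:E.
Proof.
move=> gf; rewrite /generation gsum0; last exact: at_birth_ge0.
by rewrite /at_birth /birth_time big_ord0 subr0.
Qed.

Lemma integral_generation l f : growth f ->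
  \int[P]_w generation l f w = (iter l V f t)%:E.
Proof.
elim: l f => [|l IH] f gf.
  under eq_integral do rewrite generation0 //.
  by rewrite integral_cst // [X in _ * X]probability_setT mule1.
by rewrite integral_generation_succ // IH ?iterSr //; exact: growthV.
Qed.

Lemma integral_gsum_sqr l (a : Omega -> seq nat -> \bar R) :
  (forall w u, 0 <= a w u) ->
  (forall u, measurable_fun [set: Omega] (fun w => a w u)) ->
  \int[P]_w (gsum l (a w) * gsum l (a w)) =
  gsum l (fun u => gsum l (fun v => \int[P]_w (a w u * a w v))).
Proof.
move=> a0 ma; under eq_integral do rewrite gsum_mul //.
have m2 u v : measurable_fun [set: Omega] (fun w => a w u * a w v).
  exact: emeasurable_funM.
have a2 w u v : 0 <= a w u * a w v by exact: mule_ge0.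
rewrite integral_gsum => [|w u|u].
- by apply: eq_gsum => u _; rewrite integral_gsum.
- exact: gsum_ge0.
- exact: measurable_gsum.
Qed.

(** In the double sum over generation [l] the terms off the diagonal are not
    changed when litters are replaced by their means; a diagonal term loses the
    variance of the litter. Since everything is nonnegative, sums and integrals are
    exchanged freely. *)
Lemma integral_generation_sqr_succ l f G b : primitive f G -> growth b ->
  (forall x, 0 <= q f x <= b x)%R ->
  \int[P]_w (generation l (V f) w * generation l (V f) w) <=
    \int[P]_w (generation l.+1 f w * generation l.+1 f w) <=
    \int[P]_w (generation l (V f) w * generation l (V f) w) +
    \int[P]_w generation l b w.
Proof.
move=> pfG gb qb; have [gf _ _] := pfG; have gV := growthV gf.
have -> : \int[P]_w (generation l.+1 f w * generation l.+1 f w) =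
    gsum l (fun u => gsum l (fun v => \int[P]_w (litter f u w * litter f v w))).
  under eq_integral do rewrite generation_succ //.
  by rewrite integral_gsum_sqr => [//|w u|u]; [exact: litter_ge0|exact: measurable_litter].
rewrite [X in X <= _ <= X + _]integral_gsum_sqr => [|w u|u]; last 2 first.
- exact: at_birth_ge0.
- exact: measurable_at_birth.
rewrite [X in _ <= _ + X]integral_gsum => [|w u|u]; last 2 first.
- exact: at_birth_ge0.
- exact: measurable_at_birth.
have mV u v : measurable_fun [set: Omega] (fun w => at_birth (V f) u w * at_birth (V f) v w).
  by apply: emeasurable_funM; exact: measurable_at_birth.
have V0 u v w : 0 <= at_birth (V f) u w * at_birth (V f) v w.
  by apply: mule_ge0; exact: at_birth_ge0.
have b0 u : 0 <= \int[P]_w at_birth b u w.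
  by apply: integral_ge0 => w _; exact: at_birth_ge0.
have mL u v : measurable_fun [set: Omega] (fun w => litter f u w * litter f v w).
  by apply: emeasurable_funM; exact: measurable_litter.
have diag u : \int[P]_w (at_birth (V f) u w * at_birth (V f) u w) <=
    \int[P]_w (litter f u w * litter f u w) <=
    \int[P]_w (at_birth (V f) u w * at_birth (V f) u w) + \int[P]_w at_birth b u w.
  rewrite (integral_litter_sqr _ pfG).
  have E1 w : at_birth (V f) u w * at_birth (V f) u w =
      ((V f (t - birth_time T u w)) ^+ 2)%:E by rewrite expr2 EFinM.
  have mB : measurable_fun [set: Omega] (fun w => t - birth_time T u w)%R.
    by apply: measurable_funB => //; exact: measurable_birth_time.
  have m1 : measurable_fun [set: Omega]
      (fun w => ((V f (t - birth_time T u w)) ^+ 2 + q f (t - birth_time T u w))%:E).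
    by apply/measurable_EFinP; exact: (measurableT_comp (measurable_second_moment u pfG) mB).
  rewrite -ge0_integralD //; [|by move=> w _; exact: at_birth_ge0|
    exact: measurable_at_birth].
  have q0 x : (0 <= q f x)%R by case/andP: (qb x).
  apply/andP; split; apply: ge0_le_integral => //.
  - by move=> w _; rewrite E1 lee_fin lerDl.
  - by move=> w _; rewrite lee_fin addr_ge0 ?sqr_ge0.
  - by apply: emeasurable_funD => //; exact: measurable_at_birth.
  - move=> w _; rewrite E1 -EFinD lee_fin lerD2l.
    by case/andP: (qb (t - birth_time T u w)%R).
(* The excess of a litter product over the product of the means sits on the
   diagonal. *)
have E u v : size u = l -> size v = l ->
    \int[P]_w (at_birth (V f) u w * at_birth (V f) v w) <=
    \int[P]_w (litter f u w * litter f v w) <=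
    \int[P]_w (at_birth (V f) u w * at_birth (V f) v w) +
      (if v == u then \int[P]_w at_birth b u w else 0).
  move=> ul vl; case: eqP => [->|/eqP vu]; first exact: diag.
  by rewrite adde0 integral_litter_cross ?lexx // ?ul ?vl // eq_sym.
apply/andP; split.
  by apply: le_gsum => u ul; apply: le_gsum => v vl; case/andP: (E u v ul vl).
have I0 u v : 0 <= \int[P]_w (at_birth (V f) u w * at_birth (V f) v w).
  by apply: integral_ge0 => w _; exact: V0.
rewrite -gsumD // => [|u]; last exact: gsum_ge0.
apply: le_gsum => u ul; rewrite -[X in _ + X](gsum_delta ul (b0 u)) -gsumD //.
  by apply: le_gsum => v vl; case/andP: (E u v ul vl).
by move=> v; case: ifP.
Qed.

Lemma integral_first_generation_sqr f G : primitive f G ->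
  \int[P]_w (generation 1 f w * generation 1 f w) = ((V f t) ^+ 2 + q f t)%:E.
Proof.
move=> pfG; have [gf _ _] := pfG.
have E w : generation 1 f w = litter f [::] w.
  by rewrite generation_succ // gsum0 //; exact: litter_ge0.
under eq_integral do rewrite E.
rewrite (integral_litter_sqr _ pfG).
under eq_integral do rewrite /birth_time big_ord0 subr0.
by rewrite integral_cst // [X in _ * X]probability_setT mule1.
Qed.

(** [n] applications of [integral_generation_sqr_succ]; the first generation,
    which is the litter of the ancestor, is computed exactly. *)
Lemma generation_sqr_bounds f (b : nat -> R -> R) n i :
  (forall i, exists G, primitive (iter i V f) G) ->
  (forall i, growth (b i)) ->
  (forall i x, 0 <= q (iter i V f) x <= b i x)%R ->
  let c := ((iter (n.+1 + i) V f t) ^+ 2 + q (iter (n + i) V f) t)%R in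
  c%:E <= \int[P]_w (generation n.+1 (iter i V f) w * generation n.+1 (iter i V f) w) /\
  \int[P]_w (generation n.+1 (iter i V f) w * generation n.+1 (iter i V f) w) <= (c + \sum_(l < n) iter l.+1 V (b (n.-1 - l + i)%N) t)%:E.
Proof.
move=> pf gb qb; elim: n i => [|n IH] i c.
  have [Gi pGi] := pf i.
  by rewrite (integral_first_generation_sqr pGi) big_ord0 addr0 /c; split.
have [Gi pGi] := pf i.
have /andP[h1 h2] := @integral_generation_sqr_succ n.+1 _ _ _ pGi (gb i) (qb i).
have := IH i.+1; rewrite [(n.+1 + i.+1)%N]addnS [(n + i.+1)%N]addnS => -[k1 k2].
rewrite /c; split; first exact: (le_trans k1 h1).
apply: (le_trans h2).
apply: (le_trans (leeD2r _ k2)); rewrite integral_generation // -EFinD lee_fin.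
rewrite -addrA lerD2l big_ord_recr /= subnn add0n lerD2r.
suff -> : (\sum_(l < n) iter l.+1 V (b (n.-1 - l + i.+1)%N) t =
  \sum_(l < n) iter l.+1 V (b (n - l + i)%N) t)%R by [].
apply: eq_bigr => l _; congr (iter _ V (b _) t).
by case: n {IH c h1 h2 k1 k2} l => [[]//|n l] /=; rewrite addnS -addSn -subSn // leq_ord.
Qed.

(** [ppow 0] is the indicator of the nonnegative half-line. *)
Lemma generation_countE j w :
  generation_count T j t w = fine (generation j (ppow 0) w).
Proof.
rewrite /generation_count counting_esum; congr fine.
rewrite (_ : [set u | _] = [set u | size u = j] `&` [set u | (birth_time T u w <= t)%R]) //.
rewrite esum_mkcondr; apply: eq_esum => u _.
rewrite /at_birth /ppow subr_ge0 expr0 fact0 divr1.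
rewrite (_ : (u \in _) = (birth_time T u w <= t)%R); first by case: ifP.
by apply/idP/idP; rewrite inE.
Qed.

(** The counting variable is the generation sum almost everywhere, since the
    latter has finite mean. The square of its mean cancels the leading term of
    [generation_sqr_bounds]. *)
Lemma variance_generation_count (b : nat -> R -> R) n :
  (forall i, exists G, primitive (iter i V (ppow 0)) G) ->
  (forall i, growth (b i)) ->
  (forall i x, 0 <= q (iter i V (ppow 0)) x <= b i x)%R ->
  exists v : R, 'V_P[generation_count T n.+1 t] = v%:E /\
    (q (iter n V (ppow 0)) t <= v <=
     q (iter n V (ppow 0)) t + \sum_(l < n) iter l.+1 V (b (n.-1 - l)%N) t)%R.
Proof.
move=> pf gb qb; have gs := @growth_ppow R 0.
have := generation_sqr_bounds n 0 pf gb qb; rewrite /= !addn0.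
under eq_bigr do rewrite addn0.
set c := (_ + _)%R; set I2 := \int[P]_w _ => -[lo up].
have mg := measurable_generation n.+1 gs.
have g0 w := generation_ge0 n.+1 w gs.
have Ig : \int[P]_w generation n.+1 (ppow 0) w = (iter n.+1 V (ppow 0) t)%:E.
  exact: integral_generation.
have ig : P.-integrable setT (generation n.+1 (ppow 0)).
  apply/integrableP; split => //.
  by under eq_integral do rewrite gee0_abs //; rewrite Ig ltry.
pose X := generation_count T n.+1 t.
have XE w : X w = fine (generation n.+1 (ppow 0) w) by exact: generation_countE.
have mX : measurable_fun [set: Omega] X.
  have -> : X = fine \o generation n.+1 (ppow 0) by apply/funext => w; rewrite XE.
  exact: measurableT_comp.
have X0 w : (0 <= X w)%R by rewrite XE fine_ge0.
have aeX : {ae P, forall w, generation n.+1 (ppow 0) w = (X w)%:E}.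
  by apply: filterS (integrable_ae _ ig) => // w /(_ I) fw; rewrite XE fineK.
have EX : \int[P]_w (X w)%:E = (iter n.+1 V (ppow 0) t)%:E.
  rewrite -Ig; apply: ge0_ae_eq_integral => //.
  - exact/measurable_EFinP.
  - by move=> w _; rewrite lee_fin.
  - by apply: filterS aeX => w -> _.
have EX2 : \int[P]_w ((X w) ^+ 2)%:E = I2.
  apply: ge0_ae_eq_integral => //.
  - by apply/measurable_EFinP; exact: measurable_funX.
  - exact: emeasurable_funM.
  - by move=> w _; rewrite lee_fin sqr_ge0.
  - by move=> w _; apply: mule_ge0.
  - by apply: filterS aeX => w -> _; rewrite expr2 EFinM.
have fI2 : I2 \is a fin_num.
  rewrite fin_numElt (lt_le_trans _ lo) ?ltNyr //=.
  by rewrite (le_lt_trans up) // ltry.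
have iX2 : int2 P X.
  split => //; apply/integrableP; split.
    by apply/measurable_EFinP; exact: measurable_funX.
  under eq_integral do rewrite /= ger0_norm ?sqr_ge0 //.
  by rewrite EX2 -ge0_fin_numE // -EX2; apply: integral_ge0 => w _; rewrite lee_fin sqr_ge0.
exists (fine I2 - (iter n.+1 V (ppow 0) t) ^+ 2)%R; split.
  by rewrite variance_int2 // /Rintegral EX EX2.
move: lo up; rewrite -(fineK fI2) !lee_fin /c /=.
move: (V _ t ^+ 2)%R => F lo up; apply/andP; split; lra.
Qed.

End fixed_time.
End branching.

(** * Walks whose steps are positive almost surely *)

Section preparation.
Context {d : measure_display} {Omega : measurableType d} {R : realType}
  (P : probability Omega R).
Local Notation Ex X := (Rintegral P setT X).

(** Modifying a step on a null event makes it positive everywhere; as the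
    modification is applied to each step separately, independence and equality of
    laws are kept. *)
Definition clip (x : R) : R := if 0 < x then x else 1.

Lemma clip_gt0 x : 0 < clip x.
Proof. by rewrite /clip; case: ifP. Qed.

Lemma clip_id x : 0 < x -> clip x = x.
Proof. by rewrite /clip => ->. Qed.

Lemma measurable_clip : measurable_fun [set: R] clip.
Proof. by apply: measurable_fun_ifT => //; exact: measurable_fun_ltr. Qed.

Lemma measurable_to_sequences d2 (T2 : measurableType d2) (z : T2 -> real_sequences R) :
  (forall i, measurable_fun [set: T2] (fun w => z w i)) ->
  measurable_fun [set: T2] z.
Proof.
move=> mz; apply: measurability => //= _ [_ [i [B [mB ->]]] <-].
exact: mz.
Qed.

Variables (xi eta : {RV P >-> R}) (xis etas : nat -> Omega -> R).
Hypothesis xi_pos : {ae P, forall w, 0 < xi w}.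
Hypothesis xis_etas : independent_copies P (fun w => (xi w, eta w))
    (fun i w => (xis i w, etas i w)).
Hypothesis eta_eq_xi : {ae P, forall w, eta w = xi w}.
Hypothesis var_fin : ('V_P[xi] < +oo)%E.

Definition steps k w := clip (xis k w).

Lemma measurable_pair_copies i : measurable_fun [set: Omega] (fun w => (xis i w, etas i w)).
Proof. by case: xis_etas. Qed.

Lemma measurable_xis i : measurable_fun [set: Omega] (xis i).
Proof. exact: (measurableT_comp measurable_fst (measurable_pair_copies i)). Qed.

Lemma measurable_etas i : measurable_fun [set: Omega] (etas i).
Proof. exact: (measurableT_comp measurable_snd (measurable_pair_copies i)). Qed.

Lemma integral_steps k (h : R -> \bar R) : measurable_fun [set: R] h ->
  (forall x, 0 <= h x)%E ->
  (\int[P]_w h (steps k w) = \int[P]_w h (xi w))%E.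
Proof.
move=> mh h0; case: xis_etas => _ id _.
have mhc : measurable_fun [set: R] (fun x => h (clip x)).
  exact: (measurableT_comp mh measurable_clip).
transitivity (\int[P]_w h (clip (xi w)))%E.
  apply: (@integral_identically_distributed _ _ _ _ _ P _ _
    (fun p : R * R => h (clip p.1)) (measurable_pair_copies k) _ (id k)) => //.
  - exact: measurable_fun_pair.
  - exact: (measurableT_comp mhc measurable_fst).
apply: ge0_ae_eq_integral => //.
- exact: (measurableT_comp mhc).
- exact: (measurableT_comp mh).
by apply: filterS xi_pos => w xw _; rewrite clip_id.
Qed.

Lemma int2_xi0 : int2 P xi.
Proof. exact: int2_variance. Qed.

Lemma measurable_steps k : measurable_fun [set: Omega] (steps k).
Proof. exact: (measurableT_comp measurable_clip (measurable_xis k)). Qed.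

Lemma positive_iid_steps : positive_iid P steps.
Proof.
case: (xis_etas) => _ id ind; split.
- exact: measurable_steps.
- by move=> k w; exact: clip_gt0.
- move=> k B mB.
  have mC : measurable [set p : R * R | B (clip p.1)].
    rewrite -[X in measurable X]setTI.
    exact: (measurableT_comp measurable_clip measurable_fst).
  by have := id k _ mC; rewrite -(id 0%N _ mC).
- move=> s B us mB.
  have := ind s (fun i => [set p : R * R | B i (clip p.1)]) us.
  apply => i; rewrite -[X in measurable X]setTI.
  exact: (measurableT_comp measurable_clip measurable_fst).
- split; first exact: measurable_steps.
  apply/integrableP; split.
    by apply/measurable_EFinP; apply: measurable_funX; exact: measurable_steps.
  under eq_integral do rewrite /= ger0_norm ?sqr_ge0 //.
  rewrite (integral_steps 0 (h := fun x => (x ^+ 2)%:E)).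
  + by have [_ i2] := int2_xi0; rewrite -EFin_Ex // ltry.
  + by apply/measurable_EFinP; exact: measurable_funX.
  + by move=> x; rewrite lee_fin sqr_ge0.
Qed.

Lemma mean_steps : step_mean P steps = fine 'E_P[xi]%E.
Proof.
rewrite /step_mean /Rintegral unlock.
have -> : (\int[P]_w (steps 0 w)%:E = \int[P]_w `|(steps 0 w)|%:E)%E.
  by apply: eq_integral => w _; rewrite gtr0_norm // clip_gt0.
rewrite (integral_steps 0 (h := fun x => `|x|%:E)); last 2 first.
- by apply/measurable_EFinP; exact: normr_measurable.
- by move=> x; rewrite lee_fin.
congr fine; apply: ae_eq_integral => //.
- by apply/measurable_EFinP; exact: measurableT_comp.
- exact/measurable_EFinP.
by apply: filterS xi_pos => w xw _; rewrite gtr0_norm.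
Qed.

Lemma var_steps : step_var P steps = fine 'V_P[xi]%E.
Proof.
have [_ _ _ _ i2] := positive_iid_steps.
rewrite /step_var Ex_sqr_centered // (variance_int2 int2_xi0) /=; congr (_ - _).
  rewrite /Rintegral (integral_steps 0 (h := fun x => (x ^+ 2)%:E)) //.
  - by apply/measurable_EFinP; exact: measurable_funX.
  - by move=> x; rewrite lee_fin sqr_ge0.
by rewrite -/(step_mean P steps) mean_steps unlock.
Qed.

(** The event that a pair has a positive first component equal to the second one
    has the same probability for all copies of [(xi, eta)]. *)
Lemma ae_steps : {ae P, forall w, forall i, steps i w = xis i w /\ etas i w = xis i w}.
Proof.
apply: ae_foralln => i.
pose h (p : R * R) := (0 < p.1) && (p.2 == p.1).
have mh : measurable_fun [set: R * R] h.
  apply: measurable_and.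
    by apply: measurable_fun_ltr => //; exact: measurable_fst.
  by apply: measurable_fun_eqr; [exact: measurable_snd|exact: measurable_fst].
pose C := [set p | ~~ h p].
have mC : measurable C.
  have mf : measurable [set false] by [].
  by have := mh measurableT _ mf; rewrite setTI; congr measurable; apply/seteqP; split => p /=;
    rewrite /C /=; [move=> ->|move/negbTE].
have mX : measurable_fun [set: Omega] (fun w => (xi w, eta w)) by exact: measurable_fun_pair.
have mXC : measurable ((fun w => (xi w, eta w)) @^-1` C).
  by rewrite -[X in measurable X]setTI; exact: mX.
have PC : P ((fun w => (xis i w, etas i w)) @^-1` C) = 0%E.
  case: xis_etas => _ id _; rewrite (id i _ mC).
  apply/(negligibleP _ mXC).
  have : {ae P, forall w, h (xi w, eta w)}.
    by apply: filterS2 xi_pos eta_eq_xi => w x0 ->; rewrite /h /= x0 eqxx.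
  by apply: negligibleS => w /= /negP.
exists ((fun w => (xis i w, etas i w)) @^-1` C); split => //.
  by rewrite -[X in measurable X]setTI; exact: measurable_pair_copies.
move=> w /= nw; rewrite /C /=; apply/negP => /andP[/= x0 /eqP e].
by apply: nw; rewrite /steps clip_id.
Qed.

Lemma measurable_perturbed_walk : measurable_fun [set: Omega] (perturbed_walk xis etas).
Proof.
apply: measurable_to_sequences => i; apply: measurable_funD; last exact: measurable_etas.
by apply: measurable_sum => k; exact: measurable_xis.
Qed.

Definition step_walk w : real_sequences R := fun i => walk steps i.+1 w.

Lemma measurable_step_walk : measurable_fun [set: Omega] step_walk.
Proof.
apply: measurable_to_sequences => i.
exact: (measurable_walk positive_iid_steps).
Qed.

(** Almost surely the perturbed walk is the walk with steps [steps], shifted by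
    one index. *)
Lemma integral_walk_copies (Z : Omega -> real_sequences R) (h : real_sequences R -> \bar R) :
  measurable_fun [set: Omega] Z ->
  identically_distributed P Z (perturbed_walk xis etas) ->
  measurable_fun [set: real_sequences R] h -> (forall z, 0 <= h z)%E ->
  (\int[P]_w h (Z w) = \int[P]_w h (step_walk w))%E.
Proof.
move=> mZ idZ mh h0.
rewrite (integral_identically_distributed mZ measurable_perturbed_walk idZ mh h0).
apply: ge0_ae_eq_integral => //.
- exact: (measurableT_comp mh measurable_perturbed_walk).
- exact: (measurableT_comp mh measurable_step_walk).
apply: filterS ae_steps => w H _; congr h; apply/funext => i.
rewrite /perturbed_walk /step_walk walkS /walk; have [-> ->] := H i; congr (_ + _).
by apply: eq_bigr => k _; have [->] := H k.
Qed.

End preparation.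

(** * Variance of the generation sizes *)

Lemma ereal_cvg_EFin (R : realType) (F : R -> \bar R) (u : R -> R) (l : R) :
  (forall t, F t = (u t)%:E) -> u t @[t --> +oo] --> l -> F t @[t --> +oo] --> l%:E.
Proof.
move=> Fu ul; under eq_fun do rewrite Fu.
by apply: cvg_EFin => //; exact: nearW.
Qed.

Lemma asym_sum0 (R : realType) n (F : nat -> R -> R) p :
  (forall l, (l < n)%N -> asym (F l) p 0) -> asym (fun t => \sum_(l < n) F l t) p 0.
Proof.
elim: n => [|n IH] F0; rewrite /asym.
  have -> : (fun t : R => (\sum_(l < 0) F l t) / t ^+ p) = (fun=> 0).
    by apply/funext => t; rewrite big_ord0 mul0r.
  exact: cvg_cst.
have -> : (fun t => (\sum_(l < n.+1) F l t) / t ^+ p) =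
    (fun t => (\sum_(l < n) F l t) / t ^+ p + F n t / t ^+ p).
  by apply/funext => t; rewrite big_ord_recr mulrDl.
rewrite -[X in _ --> X]addr0; apply: cvgD; last exact: F0.
by apply: IH => l ln; apply: F0; exact: ltnW.
Qed.

Theorem theorem2p6 (d : measure_display) (Omega : measurableType d)
  (R : realType) (P : probability Omega R)
  (xi eta : {RV P >-> R})
  (xis etas : nat -> Omega -> R)
  (T : seq nat -> Omega -> real_sequences R)
  (xi_pos : {ae P, forall w, 0 < xi w})
  (eta_pos : {ae P, forall w, 0 < eta w})
  (xis_etas : independent_copies P (fun w => (xi w, eta w))
    (fun i w => (xis i w, etas i w)))
  (T_copies : independent_copies P (perturbed_walk xis etas) T)
  (eta_eq_xi : {ae P, forall w, eta w = xi w})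
  (xi_nonlattice : nonlattice P xi)
  (var_pos : (0 < 'V_P[xi])%E)
  (var_fin : ('V_P[xi] < +oo)%E)
  (j : nat) (j_pos : (0 < j)%N) :
  let m : R := fine 'E_P[xi] in
  let s2 : R := fine 'V_P[xi] in
  ('E_P[xi] < +oo)%E /\
  ('V_P[generation_count T j t] * ((t ^+ (2 * j - 1))^-1)%:E)%E
    @[t --> +oo%R] -->
  (s2 / ((2 * j - 1)%:R * ((j - 1)`!)%:R ^+ 2 * m ^+ (2 * j + 1)))%:E.
Proof.
move=> m s2.
have [mT idT indT] := T_copies.
have iid := positive_iid_steps xi_pos xis_etas var_fin.
have i2 := int2_xi0 var_fin.
set xs := steps xis in iid.
have mE : step_mean P xs = m by exact: (mean_steps xi_pos xis_etas).
have sE : step_var P xs = s2 by exact: (var_steps xi_pos xis_etas var_fin).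
have m0 : 0 < m by rewrite -mE; exact: mean_gt0.
split.
  have := integrable_lty measurableT (int2_int1 i2).
  by rewrite unlock.
(* With [j = n.+1] the exponent is [2 * n + 1], and [f_ i] below is the expected
   size of generation [i]. *)
case: j j_pos => // n _.
have nE : (2 * n.+1 - 1)%N = n.*2.+1 by rewrite mul2n doubleS subn1.
rewrite nE subn1 /=.
pose V := descend P xs; pose q := renewal_var P xs.
have Hmean u f t : growth f -> (\int[P]_w offspring f (T u w) t = (V f t)%:E)%E.
  move=> gf; rewrite (integral_walk_copies xi_pos xis_etas eta_eq_xi var_fin
    (h := fun z => offspring f z t) (mT u) (idT u)).
  - exact: integral_offspring.
  - exact: (measurable_offspring_comp gf (@measurable_id _ _ _) (@measurable_cst _ _ _ _ _ t)).
  - by move=> z; exact: offspring_ge0.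
have Hsq u f G t : primitive f G ->
    (\int[P]_w (offspring f (T u w) t * offspring f (T u w) t) =
    ((V f t) ^+ 2 + q f t)%:E)%E.
  move=> pfG; have [gf _ _] := pfG.
  have mO : measurable_fun [set: real_sequences R] (fun z => offspring f z t).
    exact: (measurable_offspring_comp gf (@measurable_id _ _ _) (@measurable_cst _ _ _ _ _ t)).
  rewrite (integral_walk_copies xi_pos xis_etas eta_eq_xi var_fin
    (h := fun z => (offspring f z t * offspring f z t)%E) (mT u) (idT u)).
  - exact: (integral_offspring_sqr iid t pfG).
  - exact: emeasurable_funM.
  - by move=> z; apply: mule_ge0; exact: offspring_ge0.
have gV f : growth f -> growth (V f) by exact: growth_descend.
pose f_ i := iter i V (ppow 0).
have pf i : primitive (f_ i) (iter i V (ppow 1)) by exact: (primitive_iter iid).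
have gf i : growth (f_ i) by case: (pf i).
have bf i : poly_bounded (f_ i) i.
  elim: i => [|i IH]; first exact: poly_bounded_step.
  exact: (poly_bounded_descend iid).
have [b Hb] := choice (fun i => renewal_var_bound iid (pf i) (bf i)).
have gb i : growth (b i) by case: (Hb i).
have qb i x : 0 <= q (f_ i) x <= b i x by case: (Hb i).
pose rest t := \sum_(l < n) iter l.+1 V (b (n.-1 - l)%N) t.
have key t := variance_generation_count mT indT gV Hmean Hsq t n
  (fun i => ex_intro _ _ (pf i)) gb qb.
(* [v t] is the variance as a real number. *)
have [v Hv] := choice key.
have ae : asym (f_ n) n ((n`!)%:R * m ^+ n)^-1.
  by have := @asym_iter _ _ _ P xs iid n 0; rewrite add0n mE.
have cq : asym (q (f_ n)) n.*2.+1
    (s2 / ((n.*2.+1)%:R * (n`!)%:R ^+ 2 * m ^+ (2 * n.+1 + 1))).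
  have f0 : n = 0%N -> f_ n = ppow 0 by move=> ->.
  have := asym_renewal_var iid (pf n) ae (asym_renewal_sqr iid (pf n) ae f0).
  rewrite mE sE; set l := _ / m ^+ 2; suff -> : l = s2 / (n.*2.+1%:R *
    (n`!)%:R ^+ 2 * m ^+ (2 * n.+1 + 1)) by [].
  have E (N F p : R) : N != 0 -> F != 0 -> p != 0 -> s2 * ((F * p)^-1 ^+ 2 / (N * m)) / m ^+ 2 =
      s2 / (N * F ^+ 2 * (p ^+ 2 * m ^+ 3)).
    by move=> N0 F0 p0; field; rewrite N0 F0 p0 gt_eqF.
  rewrite /l E ?pnatr_eq0 // -?lt0n ?fact_gt0 //; last by rewrite expf_neq0 ?gt_eqF.
  by rewrite -exprM -exprD; congr (_ / (_ * m ^+ _)); rewrite muln2 mul2n doubleS addn1 !addnS addn0.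
have gi l i : growth (iter l V (b i)) by elim: l => //= l IH; exact: gV.
have pb l i : poly_bounded (iter l V (b i)) (l + i.*2.+1).
  elim: l => [|l IH] /=; first by case: (Hb i).
  exact: (poly_bounded_descend iid).
have cr : asym rest n.*2.+1 0.
  apply: (asym_sum0 (F := fun l => iter l.+1 V (b (n.-1 - l)%N))) => l ln.
  apply: (poly_bounded_asym _ (pb l.+1 (n.-1 - l)%N)) => //.
  set k := (n.-1 - l)%N; have nk : n = (l + k).+1.
    by rewrite /k subnKC ?prednK ?(leq_ltn_trans _ ln) // -ltnS prednK ?(leq_ltn_trans _ ln).
  by rewrite [in X in (_ < X)%N]nk doubleS doubleD !addSn !addnS !ltnS leq_add2r -addnn leq_addl.
apply: (@ereal_cvg_EFin R _ (fun t => v t / t ^+ n.*2.+1)).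
  by move=> t; have [-> _] := Hv t; rewrite -EFinM.
apply: (squeeze_cvgr (h := fun t => q (f_ n) t / t ^+ n.*2.+1 + rest t / t ^+ n.*2.+1)
  _ cq); last by rewrite -[X in _ --> X]addr0; exact: cvgD cq cr.
near=> t.
have t0 : 0 < t by near: t; exact: nbhs_pinfty_gt.
have iT : 0 <= (t ^+ n.*2.+1)^-1 by rewrite invr_ge0 exprn_ge0 // ltW.
have [_ /andP[lo up]] := Hv t.
by rewrite -mulrDl; apply/andP; split; apply: ler_wpM2r.
Unshelve. all: by end_near. Qed.
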